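(* Let $\mathcal{A}=\varinjlim(\mathcal{A}_i,\varphi_i)$ be a strongly maximal TAF algebra and let $\rho:\mathcal{A}\to\operatorname{Alg}\mathcal{N}$ be a nest representation with (norm) closed range. Then the compact operators in $\rho(\mathcal{A})$ form a closed ideal of $\operatorname{Alg}\mathcal{N}$.
   Context: Strongly maximal TAF algebra: for each $i\in\mathbb{N}$, let $\mathfrak{A}_i$ be a finite direct sum of full complex matrix algebras and $\mathcal{A}_i\subseteq\mathfrak{A}_i$ the corresponding direct sum of the upper triangular matrix subalgebras. Let $\varphi_i:\mathfrak{A}_i\to\mathfrak{A}_{i+1}$ be an injective $*$-homomorphism with $\varphi_i(\mathcal{A}_i)\subseteq\mathcal{A}_{i+1}$ (the embedding of $\mathcal{A}_i$ is $*$-extendable) which is regular, i.e. maps each matrix unit to a sum of matrix units. Then $\mathcal{A}=\varinjlim(\mathcal{A}_i,\varphi_i)$ is the norm closure of $\bigcup_i\mathcal{A}_i$ inside the AF C*-algebra $\mathfrak{A}=\varinjlim(\mathfrak{A}_i,\varphi_i)$. Nest representation: a representation is a bounded algebra homomorphism $\rho:\mathcal{A}\to B(\mathcal{H})$, $\mathcal{H}$ a Hilbert space; it is a nest representation if the lattice $\operatorname{Lat}\rho(\mathcal{A})$ of closed $\rho(\mathcal{A})$-invariant subspaces is linearly ordered, i.e. a nest $\mathcal{N}$. Writing $\rho:\mathcal{A}\to\operatorname{Alg}\mathcal{N}$ means $\mathcal{N}=\operatorname{Lat}\rho(\mathcal{A})$, where $\operatorname{Alg}\mathcal{N}$ is the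 algebra of bounded operators leaving every element of $\mathcal{N}$ invariant. Ideals are two-sided. *)

(* Defs.v *)
From HB Require Import structures.
From mathcomp Require Import all_boot all_order all_algebra sesquilinear spectral.
From mathcomp Require Import complex.
From mathcomp Require Import all_classical all_reals all_analysis.

Set Implicit Arguments.
Unset Strict Implicit.
Unset Printing Implicit Defensive.

Import Order.TTheory GRing.Theory Num.Theory.
Import numFieldNormedType.Exports.

Local Open Scope classical_set_scope.
Local Open Scope ring_scope.
Local Open Scope complex_scope.

(* A C*-algebra, possibly without unit.  Norms of complex normed modules are
   elements of R[i] that happen to be real and nonnegative. *)
HB.mixin Record isCStarAlgebra (R : realType) A
    of CompleteNormedModule R[i] A := {
  cmul : A -> A -> A;
  cstar : A -> A;
  cmulA : associative cmul;
  cmul_linearl : forall b, linear (cmul ^~ b);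
  cmul_linearr : forall a, linear (cmul a);
  cstarK : involutive cstar;
  cstarD : {morph cstar : a b / a + b};
  cstarZ : forall (k : R[i]) a, cstar (k *: a) = (Num.conj k) *: cstar a;
  cstarM : forall a b, cstar (cmul a b) = cmul (cstar b) (cstar a);
  cnorm_mul : forall a b, `|cmul a b| <= `|a| * `|b|;
  cnorm_star : forall a, `|cmul (cstar a) a| = `|a| ^+ 2
}.

#[short(type="cstarAlgType")]
HB.structure Definition CStarAlgebra (R : realType) :=
  {A of CompleteNormedModule R[i] A & isCStarAlgebra R A}.

(* The inner product is linear in its first argument. *)
HB.mixin Record isHilbertSpace (R : realType) H
    of CompleteNormedModule R[i] H := {
  hdot : {dot H for Num.conj};
  hdot_norm : forall x : H, `|x| ^+ 2 = hdot x x
}.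

#[short(type="hilbertType")]
HB.structure Definition HilbertSpace (R : realType) :=
  {H of CompleteNormedModule R[i] H & isHilbertSpace R H}.

Section MultiMatrix.
Variables (R : realType) (J : finType) (n : J -> nat).

(* The direct sum of the full matrix algebras M_(n j)(C), j in J. *)
Definition multimx := forall j : J, 'M[R[i]]_(n j).

Definition mmlin (k : R[i]) (a b : multimx) : multimx :=
  fun j => k *: a j + b j.
Definition mmmul (a b : multimx) : multimx := fun j => a j *m b j.
Definition mmstar (a : multimx) : multimx := fun j => ((a j) ^t*)%sesqui.

(* is_trig_mx means lower triangular. *)
Definition upper_triangular : set multimx :=
  [set a | forall j, is_trig_mx (a j)^T].

Definition mmunit (u : {j : J & 'I_(n j) * 'I_(n j)}%type) : multimx :=
  fun j => \matrix_(p, q) (Tagged (fun j => 'I_(n j) * 'I_(n j))%type (p, q) == u)%:R.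

Definition mmsum_units (U : {set {j : J & 'I_(n j) * 'I_(n j)}%type}) :
  multimx := fun j => \sum_(u in U) mmunit u j.

End MultiMatrix.
Arguments upper_triangular {R J n}.

Definition mm_star_hom (R : realType) (J J' : finType) (n : J -> nat)
    (n' : J' -> nat) (phi : multimx R n -> multimx R n') :=
  [/\ forall k a b, phi (mmlin k a b) = mmlin k (phi a) (phi b),
      forall a b, phi (mmmul a b) = mmmul (phi a) (phi b) &
      forall a, phi (mmstar a) = mmstar (phi a)].

Definition mm_regular (R : realType) (J J' : finType) (n : J -> nat)
    (n' : J' -> nat) (phi : multimx R n -> multimx R n') :=
  forall u, exists U, phi (mmunit R u) = mmsum_units R U.

Record taf_system (R : realType) := TafSystem {
  taf_block : nat -> finType;
  taf_size : forall i, taf_block i -> nat;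
  taf_emb : forall i,
    multimx R (@taf_size i) -> multimx R (@taf_size i.+1);
  taf_block_gt0 : forall i, (0 < #|taf_block i|)%N;
  taf_size_gt0 : forall i (j : taf_block i), (0 < taf_size j)%N;
  taf_emb_star_hom : forall i, mm_star_hom (@taf_emb i);
  taf_emb_inj : forall i, injective (@taf_emb i);
  taf_emb_upper : forall i a,
    upper_triangular a -> upper_triangular (@taf_emb i a);
  taf_emb_regular : forall i, mm_regular (@taf_emb i)
}.

(* A together with the psi i is the C*-algebraic direct limit of the full
   algebras: injective *-homomorphisms into a C*-algebra are isometric, so A is
   the completion of the increasing union of their ranges. *)
Definition cstar_limit (R : realType) (S : taf_system R) (A : cstarAlgType R)
    (psi : forall i, multimx R (@taf_size R S i) -> A) :=
  [/\ forall i, [/\ forall k a b, psi i (mmlin k a b) = k *: psi i a + psi i b,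
                    forall a b, psi i (mmmul a b) = cmul (psi i a) (psi i b),
                    forall a, psi i (mmstar a) = cstar (psi i a) &
                    injective (psi i)],
      forall i a, psi i.+1 (taf_emb a) = psi i a &
      closure (\bigcup_i range (psi i)) = setT].

Definition taf_algebra (R : realType) (S : taf_system R) (A : cstarAlgType R)
    (psi : forall i, multimx R (@taf_size R S i) -> A) : set A :=
  closure (\bigcup_i (psi i @` upper_triangular)).

Section Operators.
Variables (R : realType) (H : hilbertType R).
Implicit Types (S T : H -> H) (I B : set (H -> H)) (M N : set H).

Definition bounded_op T :=
  linear T /\ exists c : R, forall x, `|T x| <= c%:C * `|x|.

(* Meaningful only for bounded operators. *)
Definition opnorm T : R :=
  inf [set c | 0 <= c /\ forall x, `|T x| <= c%:C * `|x|].

Definition compact_op T :=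
  bounded_op T /\ precompact (T @` [set x | `|x| <= 1]).

Definition norm_closed I :=
  forall T, bounded_op T ->
    (forall e : R, 0 < e -> exists2 S, I S & opnorm (T - S) < e) -> I T.

Definition closed_ideal B I :=
  [/\ I `<=` B, I 0 /\ forall (k : R[i]) S T, I S -> I T -> I (k *: S + T),
      forall S T, B S -> I T -> I (S \o T) /\ I (T \o S) &
      norm_closed I].

Definition closed_subspace M :=
  [/\ closed M, M 0 & forall (k : R[i]) x y, M x -> M y -> M (k *: x + y)].

Definition lat B : set (set H) :=
  [set M | closed_subspace M /\ forall T x, B T -> M x -> M (T x)].

Definition alg (L : set (set H)) : set (H -> H) :=
  [set T | bounded_op T /\ forall M x, L M -> M x -> M (T x)].

(* Only the values of rho on the subset D of A matter. *)
Definition representation (A : cstarAlgType R) (D : set A) (rho : A -> H -> H) :=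
  [/\ forall a, D a -> bounded_op (rho a),
      forall (k : R[i]) a b, D a -> D b ->
        rho (k *: a + b) = k *: rho a + rho b,
      forall a b, D a -> D b -> rho (cmul a b) = rho a \o rho b &
      exists c : R, forall a, D a -> (opnorm (rho a))%:C <= c%:C * `|a|].

Definition nest_representation (A : cstarAlgType R) (D : set A)
    (rho : A -> H -> H) :=
  representation D rho /\
  forall M N, lat (rho @` D) M -> lat (rho @` D) N -> M `<=` N \/ N `<=` M.

End Operators.

(* Main.v *)
Require Import Defs.
From HB Require Import structures.
From mathcomp Require Import all_boot all_order all_algebra sesquilinear.
From mathcomp Require Import complex ring lra.
From mathcomp Require Import all_classical all_reals all_analysis.

Set Implicit Arguments.
Unset Strict Implicit.
Unset Printing Implicit Defensive.

Import Order.TTheory GRing.Theory Num.Theory.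
Import numFieldNormedType.Exports.

Local Open Scope classical_set_scope.
Local Open Scope ring_scope.
Local Open Scope complex_scope.

(** The algebra A is the limit algebra, rho the representation, B its range and
    N the lattice of B.  Compact operators in B are stable under products
    within B, so everything hinges on multiplying a compact T in B by an
    arbitrary member of Alg N without leaving B.

    For rank one operators this is automatic (rank1_absorbed).  The vectors z
    for which <., y> z lies in B form a closed B-invariant subspace, that is, a
    member of N, hence every operator of Alg N leaves it invariant; the vectors
    y for which <., y> z lies in B are treated in the same way through their
    orthogonal complement.  The operators that can be so multiplied form a norm
    closed bimodule over B (absorbed), so it suffices to approximate a compact
    T = rho a by sums of rank one operators that lie in B.

    Rank one operators come from the diagonal.  Let t_n be a decreasing sequence
    of minimal diagonal projections of higher and higher levels.  The compression
    of each level of A to t_n is eventually scalar.  If v and w are fixed by all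
    rho t_n, the cyclic subspaces of v and w are comparable because N is a nest,
    and compressing by t_n shows that v and w are proportional
    (fixed_space_line): a point of the spectrum of the diagonal carries at most
    one dimension.  Given two such sequences, with limits p and q, the operators
    rho t_n T rho t'_n converge in norm to p T q, since T is compact, and p T q
    is an operator of rank at most one in B (corner_limit).

    To reach all of T, approximate a by an element b of level i.  Each minimal
    diagonal projection of a level k >= i, carried along the matrix units of a
    block of level i, gives an orbit whose sum is a projection q_u commuting with
    level i, so that b is the sum of the q_u b q_u (cell_pinch).  Random signs,
    or rather the parallelogram law, show that T |-> sum of Q_u T Q_u, with
    Q_u = rho q_u, is bounded by a constant depending only on rho
    (block_diagonal_bound).  Hence T is close to the sum of the Q_u T Q_u, for
    every k, and it is enough that for some k every Q_u T Q_u is close to an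
    absorbed operator (approximable_eventually).  Otherwise Koenig's lemma
    provides a decreasing sequence of orbits, each having bad suborbits at
    arbitrarily high levels; along it Q T Q converges to a finite sum of
    operators p T q as above, a contradiction. *)

(** * Real norms, completeness and nets *)

(** Norms take their values in R[i], although they are real; the estimates are
    carried out in the totally ordered field R. *)
Definition nm (R : realType) (V : normedModType R[i]) (x : V) : R := complex.Re `|x|.
Definition cabs (R : realType) (k : R[i]) : R := complex.Re `|k|.

Section RealNorm.
Variables (R : realType) (V : normedModType R[i]).
Implicit Types (x y : V) (k : R[i]) (B : set V).

Lemma cabsE k : `|k| = (cabs k)%:C.
Proof. by rewrite /cabs RRe_real // normr_real. Qed.

Lemma nmE x : `|x| = (nm x)%:C.
Proof. by rewrite /nm RRe_real // normr_real. Qed.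

Lemma nm_ge0 x : 0 <= nm x.
Proof. by rewrite -lecR -nmE normr_ge0. Qed.

Lemma cabs_ge0 k : 0 <= cabs k.
Proof. by rewrite -lecR -cabsE normr_ge0. Qed.

Lemma nm0 : nm (0 : V) = 0.
Proof. by rewrite /nm normr0. Qed.

Lemma nm_eq0 x : nm x = 0 -> x = 0.
Proof. by move=> x0; apply/normr0_eq0; rewrite nmE x0. Qed.

Lemma nmN x : nm (- x) = nm x.
Proof. by rewrite /nm normrN. Qed.

Lemma nmD x y : nm (x + y) <= nm x + nm y.
Proof. by rewrite -lecR rmorphD /= -!nmE ler_normD. Qed.

Lemma nmB x y : nm (x - y) <= nm x + nm y.
Proof. by rewrite -(nmN y) nmD. Qed.

Lemma nm_distC x y : nm (x - y) = nm (y - x).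
Proof. by rewrite -nmN opprB. Qed.

Lemma nm_tri y x z : nm (x - z) <= nm (x - y) + nm (y - z).
Proof. by have := nmD (x - y) (y - z); rewrite addrA subrK. Qed.

Lemma nm_le_dist x y : nm x <= nm (x - y) + nm y.
Proof. by have := nmD (x - y) y; rewrite subrK. Qed.

Lemma nmZ k x : nm (k *: x) = cabs k * nm x.
Proof. by apply: complexI; rewrite rmorphM /= -!nmE -cabsE normrZ. Qed.

Lemma closure_nmP B x :
  closure B x <-> forall e : R, 0 < e -> exists2 b, B b & nm (x - b) < e.
Proof.
split=> [Bx e e0|Bx U].
  have /Bx [b [Bb]] : nbhs x (ball x e%:C).
    by apply: nbhsx_ballx; rewrite ltcR.
  by rewrite -ball_normE /= nmE ltcR => xb; exists b.
rewrite -nbhs_ballE => -[e /= e0 eU].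
have er : e = (complex.Re e)%:C by rewrite RRe_real // gtr0_real.
have e0' : 0 < complex.Re e by rewrite -ltcR -er.
have [b Bb xb] := Bx _ e0'; exists b; split=> //; apply: eU.
by rewrite -ball_normE /= nmE er ltcR.
Qed.

End RealNorm.

Lemma cabs_real (R : realType) (r : R) : 0 <= r -> cabs (r%:C) = r.
Proof. by move=> r0; rewrite /cabs ger0_norm ?lecR. Qed.

Section Completeness.
Variables (R : realType) (V : completeNormedModType R[i]).

Definition nm_cvg (u : nat -> V) (l : V) :=
  forall e : R, 0 < e -> exists N, forall n, (N <= n)%N -> nm (u n - l) < e.

Definition nm_cauchy (u : nat -> V) :=
  forall e : R, 0 < e -> exists N, forall m n, (N <= m)%N -> (N <= n)%N ->
    nm (u m - u n) < e.

Lemma nm_cauchy_cvg u : nm_cauchy u -> exists l, nm_cvg u l.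
Proof.
move=> cu; have /cauchy_cvg cvgu : cauchy (u @ \oo).
  apply/cauchy_ballP => e e0.
  have er : e = (complex.Re e)%:C by rewrite RRe_real // gtr0_real.
  have e0' : 0 < complex.Re e by rewrite -ltcR -er.
  have [N uN] := cu _ e0'.
  exists ([set x | exists2 n, (N <= n)%N & x = u n],
          [set x | exists2 n, (N <= n)%N & x = u n]) => /=.
    split; exists N => // n /= Nn; by exists n.
  move=> [x y] /= [[m Nm ->] [n Nn ->]].
  by rewrite -ball_normE /= nmE er ltcR uN.
exists (lim (u @ \oo)) => e e0.
have /cvgu : nbhs (lim (u @ \oo)) (ball (lim (u @ \oo)) e%:C).
  by apply: nbhsx_ballx; rewrite ltcR.
case=> N _ uN; exists N => n Nn; have := uN n Nn.
by rewrite /= -ball_normE /= nmE ltcR nm_distC.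
Qed.

End Completeness.

Section CompactNets.
Variables (R : realType) (V : completeNormedModType R[i]).

Definition has_nets (B : set V) := forall e : R, 0 < e ->
  exists l : seq V, forall y, B y -> exists2 z, z \in l & nm (y - z) < e.

Lemma precompact_nets B : precompact B -> has_nets B.
Proof.
rewrite precompactE compact_cover => cB e e0.
have [|x Bx|D DB Dcov] := cB V setT (fun x => (ball x e%:C)°%classic).
- by move=> x _; exact: open_interior.
- exists x => //; apply: nbhs_singleton; apply: nbhs_interior.
  by apply: nbhsx_ballx; rewrite ltcR.
exists (finmap.enum_fset D) => y /subset_closure /Dcov [z Dz] /interior_subset.
rewrite -ball_normE /= nmE ltcR => zy; exists z; first exact: Dz.
by rewrite nm_distC.
Qed.

(** Some ball of a finite net belongs to a given ultrafilter on the closure, so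
    the ultrafilter is Cauchy and completeness applies. *)
Lemma nets_precompact B : has_nets B -> precompact B.
Proof.
move=> nB; rewrite precompactE compact_ultra => F UF FB.
have FF : ProperFilter F by apply: ultra_proper.
suff cF : cauchy F.
  have cvF : F --> lim F by exact: cauchy_cvg.
  exists (lim F); split=> //.
  have : cluster F (lim F) by rewrite (ultra_cvg_clusterE UF).
  by rewrite clusterE => /(_ _ FB); apply: closed_closure.
apply/cauchy_ballP => e e0.
have er : e = (complex.Re e)%:C by rewrite RRe_real // gtr0_real.
have e0' : 0 < complex.Re e / 2 / 2 by rewrite !divr_gt0 // -ltcR -er.
have [l lB] := nB _ e0'.
have [z zl Fz] : exists2 z, z \in l & F [set y | nm (y - z) < complex.Re e / 2].
  have lB' : closure B `<=` \bigcup_(z in [set` l]) [set y | nm (y - z) < complex.Re e / 2].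
    move=> y /closure_nmP /(_ _ e0') [b Bb yb].
    have [z zl bz] := lB b Bb; exists z => //=.
    rewrite [ltRHS](splitr (complex.Re e / 2)).
    by apply: le_lt_trans (nm_tri b _ _) _; apply: ltrD.
  have {lB' FB} : F (\bigcup_(z in [set` l]) [set y | nm (y - z) < complex.Re e / 2]).
    exact: filterS FB.
  elim: l {lB} => [|a l IH].
    move=> F0; exfalso; apply: (filter_not_empty F).
    by apply: filterS F0 => y [z].
  have [Fa _|Fa] := in_ultra_setVsetC [set y | nm (y - a) < complex.Re e / 2] UF.
    by exists a => //; rewrite mem_head.
  move=> Fal; have [|z zl Fz] := IH.
    apply: filterS (filterI Fa Fal) => y [/= ya [z /=]].
    by rewrite inE => /orP[/eqP ->//|zl yz]; exists z.
  by exists z => //; rewrite inE zl orbT.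
exists ([set y | nm (y - z) < complex.Re e / 2], [set y | nm (y - z) < complex.Re e / 2]) => //.
move=> [x y] /= [xz yz]; rewrite -ball_normE /= nmE er ltcR (splitr (complex.Re e)).
by apply: le_lt_trans (nm_tri z _ _) _; apply: ltrD => //; rewrite nm_distC.
Qed.

End CompactNets.

Lemma small_factor (R : realType) (c e : R) : 0 <= c -> 0 < e ->
  exists2 d, 0 < d & c * d <= e.
Proof.
move=> c0 e0; have c1 : 0 < c + 1 by rewrite ltr_wpDl.
exists (e / (c + 1)); first exact: divr_gt0.
by rewrite mulrCA ger_pMr // ler_pdivrMr // mul1r lerDl.
Qed.

(** * Hilbert space geometry *)

Section HilbertGeometry.
Variables (R : realType) (H : hilbertType R).
Implicit Types (x y z w : H) (k : R[i]) (M : set H).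

Lemma nm_sqr x : ((nm x) ^+ 2)%:C = hdot x x.
Proof. by rewrite rmorphXn /= -nmE hdot_norm. Qed.

Lemma hdotC x y : hdot y x = Num.conj (hdot x y).
Proof. by rewrite hermC mul1r. Qed.

Lemma hdotDl x y z : hdot (x + y) z = hdot x z + hdot y z.
Proof. by rewrite linearDl. Qed.

Lemma hdotZl k x z : hdot (k *: x) z = k * hdot x z.
Proof. by rewrite linearZl_LR. Qed.

Lemma hdotNl x z : hdot (- x) z = - hdot x z.
Proof. by rewrite -scaleN1r hdotZl mulN1r. Qed.

Lemma hdotBl x y z : hdot (x - y) z = hdot x z - hdot y z.
Proof. by rewrite hdotDl hdotNl. Qed.

Lemma hdotDr x y z : hdot z (x + y) = hdot z x + hdot z y.
Proof. by rewrite linearDr. Qed.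

Lemma hdotZr k x z : hdot z (k *: x) = Num.conj k * hdot z x.
Proof. by rewrite linearZr_LR. Qed.

Lemma hdotNr x z : hdot z (- x) = - hdot z x.
Proof. by rewrite -scaleN1r hdotZr rmorphN1 mulN1r. Qed.

Lemma hdotBr x y z : hdot z (x - y) = hdot z x - hdot z y.
Proof. by rewrite hdotDr hdotNr. Qed.

Lemma hdot0l x : hdot 0 x = 0.
Proof. by rewrite -(scale0r 0) hdotZl mul0r. Qed.

Lemma hdot0r x : hdot x 0 = 0.
Proof. by rewrite hdotC hdot0l rmorph0. Qed.

Lemma realC2 : (2 : R)%:C = 2 :> R[i].
Proof. by rewrite -(rmorph_nat (real_complex R) 2). Qed.

Lemma parallelogram x y :
  nm (x + y) ^+ 2 + nm (x - y) ^+ 2 = 2 * (nm x ^+ 2 + nm y ^+ 2).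
Proof.
apply: complexI; rewrite rmorphM !rmorphD /= !nm_sqr.
rewrite hdotBl !hdotBr hdotDl !hdotDr.
rewrite [1%:C]rmorph1.
by ring.
Qed.

(** Pythagoras for the removal of the component along z; both the
    Cauchy-Schwarz inequality and the orthogonality of nearest points are read
    off from it. *)
Lemma nm_sub_proj w z : nm z != 0 ->
  nm (w - (hdot w z / hdot z z) *: z) ^+ 2 =
  nm w ^+ 2 - (cabs (hdot w z) / nm z) ^+ 2.
Proof.
move=> z0; have zz0 : hdot z z != 0.
  by rewrite -nm_sqr (fmorph_eq0 (real_complex R)) sqrf_eq0.
have czz : Num.conj (hdot z z) = hdot z z by rewrite -hdotC.
apply: complexI; rewrite rmorphB !rmorphXn /= fmorph_div /= -!rmorphXn /=.
rewrite !nm_sqr hdotBl !hdotBr !hdotZl !hdotZr.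
rewrite expr_div_n -[(nm z)%:C ^+ 2]rmorphXn /= nm_sqr -cabsE normCK.
rewrite fmorph_div /= czz (hdotC w z).
by field.
Qed.

Lemma cauchy_schwarz x y : cabs (hdot x y) <= nm x * nm y.
Proof.
have [/eqP y0|y0] := boolP (nm y == 0).
  by rewrite (nm_eq0 y0) hdot0r nm0 mulr0 /cabs normr0.
have y0' : 0 < nm y by rewrite lt_def y0 nm_ge0.
rewrite -ler_pdivrMr // -(@ler_pXn2r _ 2) ?nnegrE ?divr_ge0 ?nm_ge0 ?cabs_ge0 //.
by rewrite -subr_ge0 -nm_sub_proj // sqr_ge0.
Qed.

Lemma orthogonal_of_nearest w z :
  (forall k, nm w <= nm (w - k *: z)) -> hdot w z = 0.
Proof.
move=> wz; have [/eqP z0|z0] := boolP (nm z == 0).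
  by rewrite (nm_eq0 z0) hdot0r.
have := wz (hdot w z / hdot z z).
rewrite -(@ler_pXn2r _ 2) ?nnegrE ?nm_ge0 // nm_sub_proj // lerBrDr gerDl.
rewrite le_eqVlt ltNge sqr_ge0 orbF sqrf_eq0 mulf_eq0 invr_eq0 (negbTE z0) orbF.
by move=> /eqP c0; apply/eqP; rewrite -normr_eq0 cabsE c0.
Qed.

Lemma closed_subspaceP M : closed_subspace M -> forall x,
  (forall e : R, 0 < e -> exists2 y, M y & nm (x - y) < e) -> M x.
Proof. by move=> [cM _ _] x xM; apply: cM; apply/closure_nmP. Qed.

(** The parallelogram law makes a minimizing sequence Cauchy. *)
Theorem projection M x : closed_subspace M ->
  exists2 m, M m & forall z, M z -> hdot (x - m) z = 0.
Proof.
move=> cM; have [_ M0 Mlin] := cM.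
have MB y z : M y -> M z -> M (y + z).
  by move=> My Mz; rewrite -[y]scale1r; apply: Mlin.
pose D := [set nm (x - m) ^+ 2 | m in M]; pose d := inf D.
have hD : has_inf D.
  split; first by exists (nm (x - 0) ^+ 2), 0.
  by exists 0 => _ [m _ <-]; apply: sqr_ge0.
have dle m : M m -> d <= nm (x - m) ^+ 2.
  by move=> Mm; apply: ge_inf; [exact: hD.2|exists m].
have ex n : exists m, M m /\ nm (x - m) ^+ 2 < d + n.+1%:R^-1.
  have n0 : 0 < n.+1%:R^-1 :> R by rewrite invr_gt0.
  have [_ [m Mm <-] lt] := inf_adherent n0 hD.
  by exists m.
have {ex} [u uP] := choice ex.
have uD a b : nm (u a - u b) ^+ 2 < 2 * (a.+1%:R^-1 + b.+1%:R^-1).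
  have := parallelogram (x - u a) (x - u b).
  have -> : x - u a - (x - u b) = u b - u a by rewrite opprB addrC addrA subrK.
  have -> : x - u a + (x - u b) = (2%:R : R[i]) *: (x - 2^-1 *: (u a + u b)).
    rewrite scalerBr scalerA divff ?pnatr_eq0 // scale1r scaler_nat mulr2n.
    by rewrite opprD addrACA.
  have c2 : cabs (2%:R : R[i]) = 2.
    by rewrite -realC2 cabs_real.
  rewrite nmZ c2 exprMn (nm_distC (u a)).
  have [[Ma Ha] [Mb Hb]] := (uP a, uP b).
  have Mm : M (2^-1 *: (u a + u b)).
    by rewrite -[_ *: _]addr0; apply: Mlin => //; apply: MB.
  have := dle _ Mm; move: Ha Hb.
  set p := nm _ ^+ 2; set q := nm _ ^+ 2; set r := nm _ ^+ 2; set s := nm _ ^+ 2.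
  move: (a.+1%:R^-1) (b.+1%:R^-1) => al be *. lra.
have [m um] : exists m, nm_cvg u m.
  apply: nm_cauchy_cvg => e e0.
  have e2 : 0 < e ^+ 2 / 4 by rewrite divr_gt0 // exprn_gt0.
  have [N N0] : exists N, N.+1%:R^-1 < e ^+ 2 / 4.
    by have [N _ HN] := near_infty_natSinv_lt (PosNum e2); exists N; apply: HN => /=.
  have le n : (N <= n)%N -> n.+1%:R^-1 <= N.+1%:R^-1 :> R.
    by move=> Nn; rewrite lef_pV2 ?posrE // ler_nat.
  exists N => a b Na Nb; rewrite -(@ltr_pXn2r _ 2) ?nnegrE ?nm_ge0 ?ltW //.
  have := uD a b; have := le a Na; have := le b Nb; move: N0.
  by move: (a.+1%:R^-1) (b.+1%:R^-1) (N.+1%:R^-1) => al be nu *; lra.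
have Mm : M m.
  apply: (closed_subspaceP cM) => e e0; have [N uN] := um e e0.
  by exists (u N); [exact: (uP N).1|rewrite nm_distC uN].
have md : nm (x - m) ^+ 2 <= d.
  have d0 : 0 <= d by apply: lb_le_inf; [exact: hD.1|move=> _ [y _ <-]; exact: sqr_ge0].
  rewrite -(sqr_sqrtr d0) ler_pXn2r ?nnegrE ?nm_ge0 ?sqrtr_ge0 //.
  apply/ler_addgt0Pr => e e0.
  have e2 : 0 < (e / 2) ^+ 2 by rewrite exprn_gt0 // divr_gt0.
  have [N1 uN1] := um (e / 2) (divr_gt0 e0 (ltr0n _ 2)).
  have [N2 N2e] : exists N, N.+1%:R^-1 < (e / 2) ^+ 2.
    by have [N _ HN] := near_infty_natSinv_lt (PosNum e2); exists N; apply: HN => /=.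
  pose n := maxn N1 N2.
  have n2 : n.+1%:R^-1 <= N2.+1%:R^-1 :> R.
    by rewrite lef_pV2 ?posrE // ler_nat ltnS leq_maxr.
  apply: le_trans (nm_tri (u n) _ _) _.
  have := uN1 n (leq_maxl _ _) => un.
  suff : nm (x - u n) <= Num.sqrt d + e / 2 by move: un => *; lra.
  have s0 := sqrtr_ge0 d.
  rewrite -(@ler_pXn2r _ 2) ?nnegrE ?nm_ge0 ?addr_ge0 // ?divr_ge0 ?(ltW e0) //.
  rewrite sqrrD sqr_sqrtr //.
  have := (uP n).2 => un2.
  have : 0 <= Num.sqrt d * (e / 2) by rewrite mulr_ge0 // divr_ge0 // ltW.
  by move: n2 N2e un2; move: (n.+1%:R^-1) (N2.+1%:R^-1) => al be *; lra.
exists m => // z Mz; apply: orthogonal_of_nearest => k.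
rewrite -(@ler_pXn2r _ 2) ?nnegrE ?nm_ge0 // -addrA -opprD.
apply: le_trans md _; apply: dle; rewrite addrC; exact: Mlin.
Qed.

(** The representing vector is orthogonal to the kernel of f: it is a multiple
    of x0 minus its projection on the kernel, for any x0 with f x0 nonzero. *)
Theorem riesz (f : H -> R[i]) (c : R) :
  (forall k x y, f (k *: x + y) = k * f x + f y) ->
  (forall x, cabs (f x) <= c * nm x) ->
  exists y, forall x, f x = hdot x y.
Proof.
move=> flin fbd.
have f0 : f 0 = 0.
  by have := flin (-1) 0 0; rewrite scaler0 addr0 mulN1r addNr.
have [fz|] := pselect (forall x, f x = 0).
  by exists 0 => x; rewrite hdot0r.
move=> /existsNP [x0 /eqP fx0].
pose K := [set x | f x = 0].
have cK : closed_subspace K.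
  split=> //; last by move=> k x y; rewrite /K /= flin => -> ->; rewrite mulr0 addr0.
  move=> x /closure_nmP xK; apply/eqP; rewrite -normr_eq0 cabsE.
  rewrite (_ : cabs (f x) = 0) //; apply/eqP; rewrite eq_le cabs_ge0 andbT.
  apply/ler_addgt0Pr => e e0; rewrite add0r.
  have c0 : 0 < `|c| + 1 by rewrite ltr_wpDl.
  have [b Kb xb] := xK _ (divr_gt0 e0 c0).
  have -> : f x = f (x - b).
    by rewrite -[x - b]addrC -scaleN1r flin Kb mulr0 add0r.
  apply: le_trans (fbd _) _.
  apply: (@le_trans _ _ ((`|c| + 1) * nm (x - b))).
    by rewrite ler_wpM2r ?nm_ge0 //; apply: le_trans (ler_norm c) _; rewrite lerDl.
  by rewrite -ler_pdivlMl // mulrC ltW.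
have [m Km wK] := projection x0 cK.
set w := x0 - m in wK.
have fw : f w = f x0 by rewrite /w addrC -scaleN1r flin Km mulr0 add0r.
have fw0 : f w != 0 by rewrite fw.
have ww0 : hdot w w != 0.
  rewrite -nm_sqr (fmorph_eq0 (real_complex R)) sqrf_eq0; apply/eqP => /nm_eq0 w0.
  by rewrite w0 f0 eqxx in fw0.
exists (Num.conj (f w / hdot w w) *: w) => x.
have : hdot (x - (f x / f w) *: w) w = 0.
  rewrite hdotC wK ?rmorph0 // /K /= addrC -scaleNr flin.
  by rewrite mulNr divfK // addNr.
rewrite hdotBl hdotZl => /eqP; rewrite subr_eq0 => /eqP xw.
by rewrite hdotZr conjCK xw; field; rewrite fw0 ww0.
Qed.

End HilbertGeometry.

Lemma hdot_suml (R : realType) (H : hilbertType R) (I : Type) (r : seq I)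
    (F : I -> H) w : hdot (\sum_(i <- r) F i) w = \sum_(i <- r) hdot (F i) w.
Proof. by elim/big_rec2: _ => [|i y1 y2 _ <-]; rewrite ?hdot0l ?hdotDl. Qed.

Lemma hdot_sumr (R : realType) (H : hilbertType R) (I : Type) (r : seq I)
    (F : I -> H) w : hdot w (\sum_(i <- r) F i) = \sum_(i <- r) hdot w (F i).
Proof. by elim/big_rec2: _ => [|i y1 y2 _ <-]; rewrite ?hdot0r ?hdotDr. Qed.

(** * Operators *)

Section Signs.
Variables (R : realType) (H : hilbertType R).
Implicit Types (x y : H).

(** The parallelogram law says that of the two squared norms of v + w and v - w
    one is at least, and the other at most, the sum of the squared norms of v
    and w; the signs are chosen one after the other.  This replaces averaging
    over random signs. *)
Lemma greedy_signs (I : eqType) (r : seq I) (v : I -> H) : uniq r ->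
  (exists s : I -> bool, \sum_(i <- r) nm (v i) ^+ 2 <=
     nm (\sum_(i <- r) (-1) ^+ s i *: v i) ^+ 2) /\
  (exists s : I -> bool, nm (\sum_(i <- r) (-1) ^+ s i *: v i) ^+ 2 <=
     \sum_(i <- r) nm (v i) ^+ 2).
Proof.
elim: r => [_|i r IH /= /andP[ir ur]].
  by split; exists xpred0; rewrite !big_nil nm0 expr0n.
have upd (s : I -> bool) b : \sum_(j <- r) (-1) ^+ (if j == i then b else s j) *: v j =
    \sum_(j <- r) (-1) ^+ s j *: v j.
  apply: eq_big_seq => j jr; case: eqP => // ji.
  by rewrite -ji jr in ir.
have [[s hs] [t ht]] := IH ur; split.
- have := parallelogram (v i) (\sum_(j <- r) (-1) ^+ s j *: v j).
  have [le|gt] := leP (nm (v i - \sum_(j <- r) (-1) ^+ s j *: v j) ^+ 2)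
    (nm (v i + \sum_(j <- r) (-1) ^+ s j *: v j) ^+ 2) => eq.
    exists (fun j => if j == i then false else s j).
    by rewrite !big_cons eqxx upd scale1r; lra.
  exists (fun j => if j == i then true else s j).
  rewrite !big_cons eqxx upd expr1 scaleN1r -[- v i + _]opprK opprD opprK nmN.
  by lra.
- have := parallelogram (v i) (\sum_(j <- r) (-1) ^+ t j *: v j).
  have [le|gt] := leP (nm (v i + \sum_(j <- r) (-1) ^+ t j *: v j) ^+ 2)
    (nm (v i - \sum_(j <- r) (-1) ^+ t j *: v j) ^+ 2) => eq.
    exists (fun j => if j == i then false else t j).
    by rewrite !big_cons eqxx upd scale1r; lra.
  exists (fun j => if j == i then true else t j).
  rewrite !big_cons eqxx upd expr1 scaleN1r -[- v i + _]opprK opprD opprK nmN.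
  by lra.
Qed.

Lemma square_sum_le (I : eqType) (r : seq I) (v : I -> H) (B : R) : uniq r ->
  (forall s : I -> bool, nm (\sum_(i <- r) (-1) ^+ s i *: v i) <= B) ->
  \sum_(i <- r) nm (v i) ^+ 2 <= B ^+ 2.
Proof.
move=> ur vB; have [[s hs] _] := greedy_signs v ur.
apply: le_trans hs _; have B0 : 0 <= B by apply: le_trans (vB xpred0); apply: nm_ge0.
by rewrite ler_pXn2r ?nnegrE ?nm_ge0.
Qed.

(** Otherwise infinitely many disjoint increments have norm at least e, and m of
    them, with well chosen signs, add up to a vector of norm at least
    e * sqrt m. *)
Lemma cauchy_of_bounded_variation (u : nat -> H) (B : R) :
  (forall (k : nat -> nat) m (s : nat -> bool), {homo k : a b / (a <= b)%N} ->
     nm (\sum_(i <- iota 0 m) (-1) ^+ s i *: (u (k i) - u (k i.+1))) <= B) ->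
  nm_cauchy u.
Proof.
move=> uB; apply: contrapT => ncu.
have {ncu} [e e0 eP] : exists2 e : R, 0 < e & forall N, exists n,
    (N <= n)%N /\ e <= nm (u N - u n).
  move/existsNP: ncu => [e /not_implyP [e0 ne]].
  exists (e / 2); first by rewrite divr_gt0.
  move=> N; apply: contrapT => /forallNP hN; apply: ne; exists N => m n Nm Nn.
  have lt a : (N <= a)%N -> nm (u N - u a) < e / 2.
    by move=> Na; rewrite ltNge; apply/negP => le; apply: (hN a).
  rewrite (splitr e); apply: le_lt_trans (nm_tri (u N) _ _) _.
  by rewrite ltrD // ?lt // nm_distC lt.
have [f fP] := choice eP.
(* From each k i, the next index is one at distance at least e. *)
pose k i := iter i f 0%N.
have kmono : {homo k : a b / (a <= b)%N}.
  apply: homo_leq => // [a b c|i]; [exact: leq_trans|exact: (fP _).1].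
have bnd m : m%:R * e ^+ 2 <= B ^+ 2.
  have := square_sum_le (iota_uniq 0 m) (fun s => uB k m s kmono).
  apply: le_trans; rewrite mulr_natl -{1}(size_iota 0 m) -sum1_size.
  rewrite -mulr_natl natr_sum mulr_suml.
  apply: ler_sum => i _; rewrite mul1r ler_pXn2r ?nnegrE ?nm_ge0 ?(ltW e0) //.
  exact: (fP _).2.
have e2 : 0 < e ^+ 2 by rewrite exprn_gt0.
have := bnd (Num.truncn (B ^+ 2 / e ^+ 2)).+1.
rewrite -ler_pdivlMr // leNgt => /negP; apply.
by apply: truncnS_gt.
Qed.

End Signs.

Section Operators.
Variables (R : realType) (H : hilbertType R).
Implicit Types (S T : H -> H) (x y z : H) (k : R[i]) (c e : R).

Lemma lin0 T : linear T -> T 0 = 0.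
Proof. by move=> lT; have := lT (-1) 0 0; rewrite scaler0 addr0 scaleN1r addNr. Qed.

Lemma lin_sum T (I : Type) (r : seq I) (F : I -> H) : linear T ->
  T (\sum_(i <- r) F i) = \sum_(i <- r) T (F i).
Proof.
move=> lT; elim/big_rec2: _ => [|i y1 y2 _ <-]; first exact: lin0.
by have := lT 1 (F i) y2; rewrite !scale1r.
Qed.

Lemma linD T x y : linear T -> T (x + y) = T x + T y.
Proof. by move=> lT; have := lT 1 x y; rewrite !scale1r. Qed.

Lemma linZ T k x : linear T -> T (k *: x) = k *: T x.
Proof. by move=> lT; have := lT k x 0; rewrite (lin0 lT) !addr0. Qed.

Lemma linB T x y : linear T -> T (x - y) = T x - T y.
Proof. by move=> lT; rewrite (linD _ _ lT) -scaleN1r (linZ _ _ lT) scaleN1r. Qed.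

Lemma bounded_opP T : bounded_op T <->
  linear T /\ exists2 c, 0 <= c & forall x, nm (T x) <= c * nm x.
Proof.
split=> [[lT [c cT]]|[lT [c c0 cT]]]; split=> //.
  exists `|c| => // x; rewrite -lecR rmorphM /= -!nmE.
  apply: le_trans (cT x) _; rewrite ler_wpM2r // lecR; exact: ler_norm.
by exists c => x; rewrite !nmE -rmorphM /= lecR.
Qed.

Lemma opnorm_set T : [set c | 0 <= c /\ forall x, `|T x| <= c%:C * `|x|] =
  [set c : R | 0 <= c /\ forall x, nm (T x) <= c * nm x].
Proof.
apply/seteqP; split=> c [c0 cT]; split=> // x; have := cT x.
  by rewrite !nmE -rmorphM /= lecR.
by rewrite !nmE -rmorphM /= lecR.
Qed.

Lemma opnorm_bound T x : bounded_op T -> nm (T x) <= opnorm T * nm x.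
Proof.
move=> /bounded_opP [lT [c0 c00 c0T]]; rewrite /opnorm opnorm_set.
set A := [set c | _].
have hA : has_inf A by split; [exists c0|exists 0 => c []].
have [/eqP x0|x0] := boolP (nm x == 0).
  by rewrite (nm_eq0 x0) (lin0 lT) nm0 mulr0.
have x0' : 0 < nm x by rewrite lt_def x0 nm_ge0.
rewrite -ler_pdivrMr //; apply: lb_le_inf; first exact: hA.1.
by move=> c [_ cT]; rewrite ler_pdivrMr.
Qed.

Lemma opnorm_le T e : 0 <= e -> (forall x, nm (T x) <= e * nm x) -> opnorm T <= e.
Proof.
move=> e0 eT; rewrite /opnorm opnorm_set; apply: ge_inf; last by split.
by exists 0 => c [].
Qed.

Lemma opnorm_lt T e : bounded_op T -> opnorm T < e ->
  forall x, nm (T x) <= e * nm x.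
Proof.
move=> bT lt x; apply: le_trans (opnorm_bound x bT) _.
by rewrite ler_wpM2r ?nm_ge0 // ltW.
Qed.

Lemma bounded_lin k S T : bounded_op S -> bounded_op T -> bounded_op (k *: S + T).
Proof.
move=> /bounded_opP [lS [c c0 cS]] /bounded_opP [lT [d d0 dT]].
apply/bounded_opP; split=> [h x y|].
  rewrite !fctE lS lT scalerDr (scalerDr h) !scalerA (mulrC k).
  by rewrite addrACA.
exists (cabs k * c + d); first by rewrite addr_ge0 // mulr_ge0 ?cabs_ge0.
move=> x; rewrite !fctE mulrDl; apply: le_trans (nmD _ _) _.
by rewrite lerD // nmZ -mulrA ler_wpM2l ?cabs_ge0.
Qed.

Lemma bounded_comp S T : bounded_op S -> bounded_op T -> bounded_op (S \o T).
Proof.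
move=> /bounded_opP [lS [c c0 cS]] /bounded_opP [lT [d d0 dT]].
apply/bounded_opP; split=> [h x y|]; first by rewrite /= lT lS.
exists (c * d); first exact: mulr_ge0.
by move=> x /=; apply: le_trans (cS _) _; rewrite -mulrA ler_wpM2l.
Qed.

Lemma bounded_sub S T : bounded_op S -> bounded_op T -> bounded_op (S - T).
Proof. by move=> bS bT; rewrite addrC -scaleN1r; apply: bounded_lin. Qed.

(** A bound on the operator norm of T - S that does not mention an infimum. *)
Definition near_op T S e := forall x, nm (T x - S x) <= e * nm x.

Lemma norm_closed_near (I : set (H -> H)) T : norm_closed I ->
  bounded_op T -> (forall e, 0 < e -> exists2 S, I S & near_op T S e) -> I T.
Proof.
move=> cI bT TI; apply: cI => // e e0.
have e2 : 0 < e / 2 by rewrite divr_gt0.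
have [S IS TS] := TI _ e2; exists S => //.
apply: le_lt_trans (opnorm_le (ltW e2) _) _; last by rewrite gtr_pMr // invf_lt1 // ltr1n.
by move=> x; rewrite fctE.
Qed.

End Operators.

Section CompactOps.
Variables (R : realType) (H : hilbertType R).
Implicit Types (S T : H -> H) (x y z : H) (k : R[i]) (c e : R).

Lemma compact_opP T : compact_op T <-> bounded_op T /\
  forall e, 0 < e -> exists l : seq H, forall x, nm x <= 1 ->
    exists2 z, z \in l & nm (T x - z) < e.
Proof.
have ball1 x : (`|x| <= 1) = (nm x <= 1) by rewrite nmE -lecR rmorph1.
split=> [[bT /precompact_nets nT]|[bT nT]]; split=> //.
  move=> e e0; have [l lP] := nT e e0; exists l => x x1.
  by apply: lP; exists x => //=; rewrite ball1.
apply: nets_precompact => e e0; have [l lP] := nT e e0; exists l.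
by move=> _ [x /= x1 <-]; apply: lP; rewrite -ball1.
Qed.

Lemma compact_op0 : compact_op (0 : H -> H).
Proof.
have z0 x : (0 : H -> H) x = 0 by [].
apply/compact_opP; split.
  apply/bounded_opP; split=> [k x y|]; first by rewrite !z0 scaler0 addr0.
  by exists 0 => // x; rewrite z0 nm0 mul0r.
by move=> e e0; exists [:: 0] => x _; exists 0; rewrite ?mem_head // z0 subr0 nm0.
Qed.

Lemma compact_op_lin k S T : compact_op S -> compact_op T ->
  compact_op (k *: S + T).
Proof.
move=> /compact_opP [bS nS] /compact_opP [bT nT]; apply/compact_opP.
split=> [|e e0]; first exact: bounded_lin.
have k0 : 0 < cabs k + 1 by rewrite ltr_wpDl ?cabs_ge0.
have [l lP] := nS _ (divr_gt0 e0 (mulr_gt0 k0 (ltr0n R 2))).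
have [m mP] := nT _ (divr_gt0 e0 (ltr0n R 2)).
exists [seq k *: a + b | a <- l, b <- m] => x x1.
have [a al Sa] := lP x x1; have [b bm Tb] := mP x x1.
exists (k *: a + b); first by apply/allpairsP; exists (a, b).
rewrite !fctE opprD addrACA -scalerBr; apply: le_lt_trans (nmD _ _) _.
rewrite nmZ (splitr e); apply: ler_ltD => //.
apply: (@le_trans _ _ ((cabs k + 1) * nm (S x - a))).
  by rewrite ler_wpM2r ?nm_ge0 // lerDl.
by rewrite -ler_pdivlMl //; apply: le_trans (ltW Sa) _; rewrite invfM mulrCA.
Qed.

Lemma compact_op_compl S T : bounded_op S -> compact_op T -> compact_op (S \o T).
Proof.
move=> bS /compact_opP [bT nT]; apply/compact_opP.
split=> [|e e0]; first exact: bounded_comp.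
have /bounded_opP [lS [c c0 cS]] := bS.
have c1 : 0 < c + 1 by rewrite ltr_wpDl.
have [l lP] := nT _ (divr_gt0 e0 c1).
exists (map S l) => x x1; have [a al Ta] := lP x x1.
exists (S a); first exact: map_f.
rewrite /= -(linB _ _ lS); apply: le_lt_trans (cS _) _.
apply: (@le_lt_trans _ _ ((c + 1) * nm (T x - a))).
  by rewrite ler_wpM2r ?nm_ge0 // lerDl.
by rewrite -ltr_pdivlMl // mulrC.
Qed.

Lemma compact_op_compr S T : bounded_op S -> compact_op T -> compact_op (T \o S).
Proof.
move=> bS /compact_opP [bT nT]; apply/compact_opP.
split=> [|e e0]; first exact: bounded_comp.
have /bounded_opP [lS [c c0 cS]] := bS.
have /bounded_opP [lT _] := bT.
have c1 : 0 < c + 1 by rewrite ltr_wpDl.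
have C1 : 0 < cabs (c + 1)%:C by rewrite cabs_real // ltW.
have [l lP] := nT _ (divr_gt0 e0 C1).
exists [seq (c + 1)%:C *: a | a <- l] => x x1.
have Sx1 : nm (((c + 1)^-1)%:C *: S x) <= 1.
  rewrite nmZ cabs_real ?invr_ge0 ?(ltW c1) // ler_pdivrMl // mulr1.
  apply: le_trans (cS x) _; apply: le_trans (ler_wpM2l c0 x1) _.
  by rewrite mulr1 lerDl.
have [a al Ta] := lP _ Sx1; exists ((c + 1)%:C *: a); first exact: map_f.
have -> : (T \o S) x - (c + 1)%:C *: a =
    (c + 1)%:C *: (T (((c + 1)^-1)%:C *: S x) - a).
  rewrite scalerBr (linZ _ _ lT) scalerA -rmorphM /= divff ?gt_eqF //.
  by rewrite scale1r.
by rewrite nmZ -ltr_pdivlMl // mulrC.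
Qed.

Lemma compact_op_closed T : bounded_op T ->
  (forall e, 0 < e -> exists2 S, compact_op S & near_op T S e) -> compact_op T.
Proof.
move=> bT TS; apply/compact_opP; split=> // e e0.
have e2 : 0 < e / 2 by rewrite divr_gt0.
have [S /compact_opP [_ nS] nTS] := TS _ e2.
have [l lP] := nS _ e2; exists l => x x1.
have [a al Sa] := lP x x1; exists a => //.
apply: le_lt_trans (nm_tri (S x) _ _) _; rewrite [ltRHS](splitr e).
apply: ler_ltD => //; apply: le_trans (nTS x) _.
by rewrite -[leRHS]mulr1 ler_wpM2l // ltW.
Qed.

End CompactOps.

Section MoreHilbert.
Variables (R : realType) (H : hilbertType R).
Implicit Types (v w x : H).

(** A line is closed: the component of w orthogonal to v is not longer than any
    difference w - k v. *)
Lemma line_limit v w : (forall e : R, 0 < e -> exists k, nm (w - k *: v) < e) ->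
  exists k, w = k *: v.
Proof.
move=> wv; have [/eqP v0|v0] := boolP (nm v == 0).
  exists 0; rewrite scale0r; apply/nm_eq0/eqP; rewrite eq_le nm_ge0 andbT.
  apply/ler_addgt0Pr => e /wv [k]; rewrite (nm_eq0 v0) scaler0 subr0 add0r.
  exact: ltW.
have vv0 : hdot v v != 0.
  by rewrite -nm_sqr (fmorph_eq0 (real_complex R)) sqrf_eq0.
exists (hdot w v / hdot v v); apply/eqP; rewrite -subr_eq0; apply/eqP.
set u := w - _; apply: nm_eq0; apply/eqP; apply: contrapT => /negP u0.
have u0' : 0 < nm u by rewrite lt_def u0 nm_ge0.
have uv : hdot u v = 0 by rewrite hdotBl hdotZl divfK // subrr.
have [k] := wv _ u0'; rewrite ltNge => /negP; apply.
have uu : hdot (w - k *: v) u = hdot u u.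
  have -> : w - k *: v = u + (hdot w v / hdot v v - k) *: v.
    by rewrite scalerBl addrA subrK.
  by rewrite hdotDl hdotZl (hdotC u v) uv rmorph0 mulr0 addr0.
rewrite -(ler_pM2r u0') -expr2; apply: le_trans _ (cauchy_schwarz _ _).
by rewrite uu -nm_sqr cabs_real // sqr_ge0.
Qed.

Lemma nm_cvg_unique (u : nat -> H) l l' : nm_cvg u l -> nm_cvg u l' -> l = l'.
Proof.
move=> ul ul'; apply/eqP; rewrite -subr_eq0; apply/eqP/nm_eq0/eqP.
rewrite eq_le nm_ge0 andbT; apply/ler_addgt0Pr => e e0; rewrite add0r.
have e2 : 0 < e / 2 by rewrite divr_gt0.
have [N uN] := ul _ e2; have [M uM] := ul' _ e2.
apply: le_trans (nm_tri (u (maxn N M)) _ _) _; rewrite [leRHS]splitr nm_distC.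
by rewrite lerD // ltW // ?uN ?uM // ?leq_maxl ?leq_maxr.
Qed.

Lemma nm_cvg_lin k (u v : nat -> H) l m : nm_cvg u l -> nm_cvg v m ->
  nm_cvg (fun n => k *: u n + v n) (k *: l + m).
Proof.
move=> ul vm e e0; have e2 : 0 < e / 2 by rewrite divr_gt0.
have [d d0 dP] := small_factor (cabs_ge0 k) e2.
have [N uN] := ul _ d0; have [M vM] := vm _ e2.
exists (maxn N M) => n; rewrite geq_max => /andP[Nn Mn].
rewrite opprD addrACA -scalerBr; apply: le_lt_trans (nmD _ _) _.
rewrite [ltRHS]splitr; apply: ler_ltD; last exact: vM.
rewrite nmZ; apply: le_trans dP; rewrite ler_wpM2l ?cabs_ge0 // ltW //.
exact: uN.
Qed.

Lemma nm_cvg_bound (u : nat -> H) l (c : R) : nm_cvg u l ->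
  (forall n, nm (u n) <= c) -> nm l <= c.
Proof.
move=> ul uc; apply/ler_addgt0Pr => e e0; have [N uN] := ul _ e0.
apply: le_trans (nm_le_dist l (u N)) _; rewrite addrC lerD //.
by rewrite nm_distC ltW // uN.
Qed.

Lemma unit_ball_bound (D : H -> H) (e : R) : linear D ->
  (forall x, nm x <= 1 -> nm (D x) <= e) -> forall x, nm (D x) <= e * nm x.
Proof.
move=> lD De x; have [/eqP x0|x0] := boolP (nm x == 0).
  by rewrite (nm_eq0 x0) (lin0 lD) nm0 mulr0.
have x0' : 0 < nm x by rewrite lt_def x0 nm_ge0.
have := De (((nm x)^-1)%:C *: x).
rewrite (linZ _ _ lD) !nmZ cabs_real ?invr_ge0 ?nm_ge0 // mulVf // => /(_ (lexx _)).
by rewrite ler_pdivrMl // mulrC.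
Qed.

Lemma nm_cvg_finite (u : nat -> H -> H) (P : H -> H) (l : seq H) (e : R) :
  (forall x, nm_cvg (fun n => u n x) (P x)) -> 0 < e ->
  exists N, forall n, (N <= n)%N -> forall z, z \in l -> nm (u n z - P z) < e.
Proof.
move=> uP e0; elim: l => [|z l [N IH]]; first by exists 0%N.
have [M uM] := uP z _ e0; exists (maxn N M) => n.
rewrite geq_max => /andP[Nn Mn] y; rewrite inE => /orP[/eqP ->|yl].
  exact: uM.
exact: IH.
Qed.

(** Pointwise convergence is uniform on a finite net of the image of the unit
    ball, and the common bound c spreads it to the whole image. *)
Lemma compact_uniform (u : nat -> H -> H) (P T : H -> H) (c : R) : 0 <= c ->
  (forall n, linear (u n)) -> (forall n x, nm (u n x) <= c * nm x) ->
  (forall x, nm_cvg (fun n => u n x) (P x)) -> compact_op T ->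
  forall e, 0 < e -> exists N, forall n, (N <= n)%N ->
    forall x, nm (u n (T x) - P (T x)) <= e * nm x.
Proof.
move=> c0 lu uc uP /compact_opP [bT nT] e e0.
have [lT _] := bT.
have lP : linear P.
  move=> k x y; apply: nm_cvg_unique (uP _) _.
  rewrite (_ : (fun n => _) = (fun n => k *: u n x + u n y)).
    exact: nm_cvg_lin.
  by apply: funext => n; rewrite lu.
have cP x : nm (P x) <= c * nm x by apply: nm_cvg_bound (uP x) _ => n.
have e3 : 0 < e / 3 by rewrite divr_gt0.
have [d d0 dP] := small_factor c0 e3.
have [l lT'] := nT _ d0.
have [N NP] := nm_cvg_finite l uP e3.
exists N => n Nn; apply: (@unit_ball_bound (fun x => u n (T x) - P (T x))).
  move=> k x y; rewrite lT lu lP scalerBr opprD addrACA //.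
move=> x x1; have [z zl Tz] := lT' x x1.
have small (V : H -> H) : (forall y, nm (V y) <= c * nm y) -> nm (V (T x - z)) <= e / 3.
  move=> Vc; apply: le_trans (Vc _) _; apply: le_trans dP.
  by rewrite ler_wpM2l // ltW.
have -> : u n (T x) - P (T x) = u n (T x - z) + (u n z - P z) - P (T x - z).
  rewrite (linB _ _ (lu n)) (linB _ _ lP) opprB !addrA.
  by rewrite !subrK.
apply: le_trans (nmB _ _) _; apply: le_trans (lerD (nmD _ _) (lexx _)) _.
have := small (u n) (uc n); have := small P cP; have := ltW (NP n Nn z zl).
by move=> *; lra.
Qed.

End MoreHilbert.

(** * Absorbed operators *)

Section AbsorbedOperators.
Variables (R : realType) (H : hilbertType R) (B : set (H -> H)).
Hypothesis B_bounded : forall T, B T -> bounded_op T.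
Hypothesis B_lin : forall (k : R[i]) S T, B S -> B T -> B (k *: S + T).
Hypothesis B_comp : forall S T, B S -> B T -> B (S \o T).
Hypothesis B_closed : norm_closed B.
Hypothesis B_0 : B 0.
Implicit Types (S T : H -> H) (x y z : H) (k : R[i]).

(** The operators of B that behave as if they were in an ideal of Alg (Lat B).
    They form a norm closed bimodule over B, so that membership may be checked
    on summands, factors and limits. *)
Definition absorbed : set (H -> H) :=
  [set T | B T /\ forall S, alg (lat B) S -> B (S \o T) /\ B (T \o S)].

Definition rank1 y z : H -> H := fun x => hdot x y *: z.

Lemma sub_alg_lat S : B S -> alg (lat B) S.
Proof. by move=> BS; split; [exact: B_bounded|move=> x M [_ MB]; exact: MB]. Qed.

Lemma alg_lat_comp S T : alg (lat B) S -> alg (lat B) T -> alg (lat B) (S \o T).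
Proof.
move=> [bS iS] [bT iT]; split; first exact: bounded_comp.
by move=> M x LM Mx; apply: iS => //; apply: iT.
Qed.

Lemma absorbed_lin k S T : absorbed S -> absorbed T -> absorbed (k *: S + T).
Proof.
move=> [BS aS] [BT aT]; split; first exact: B_lin.
move=> U [bU iU]; have [US SU] := aS U (conj bU iU); have [UT TU] := aT U (conj bU iU).
split; last exact: (B_lin k SU TU).
have -> : U \o (k *: S + T) = k *: (U \o S) + (U \o T).
  by apply: funext => x; have [lU _] := bU; rewrite !fctE; exact: lU.
exact: B_lin.
Qed.

Lemma absorbed0 : absorbed 0.
Proof.
split=> // U [bU iU]; split; last exact: B_0.
rewrite (_ : U \o 0 = 0) //; apply: funext => x; apply: lin0.
by have [] := bU.
Qed.

Lemma absorbed_sum (I : Type) (r : seq I) (F : I -> H -> H) :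
  (forall i, absorbed (F i)) -> absorbed (fun x => \sum_(i <- r) F i x).
Proof.
move=> aF; elim: r => [|i r IH].
  by rewrite (_ : (fun _ => _) = 0) ?funeqE => [|x]; [exact: absorbed0|rewrite big_nil].
rewrite (_ : (fun _ => _) = 1 *: F i + (fun x => \sum_(i <- r) F i x)).
  exact: absorbed_lin.
by apply: funext => x; rewrite big_cons !fctE scale1r.
Qed.

Lemma absorbed_compl S T : B S -> absorbed T -> absorbed (S \o T).
Proof.
move=> BS [BT aT]; split; first exact: B_comp.
move=> U aU; split; last exact: (B_comp BS (aT U aU).2).
by apply: (aT (U \o S) _).1; apply: alg_lat_comp => //; apply: sub_alg_lat.
Qed.

Lemma absorbed_compr S T : B S -> absorbed T -> absorbed (T \o S).
Proof.
move=> BS [BT aT]; split; first exact: B_comp.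
move=> U aU; split; first exact: (B_comp (aT U aU).1 BS).
by apply: (aT (S \o U) _).2; apply: alg_lat_comp => //; apply: sub_alg_lat.
Qed.

Lemma absorbed_closed T : B T ->
  (forall e, 0 < e -> exists2 S, absorbed S & near_op T S e) -> absorbed T.
Proof.
move=> BT TS; split=> // U aU; have [bU _] := aU.
have /bounded_opP [lU [c c0 cU]] := bU.
have c1 : 0 < c + 1 by rewrite ltr_wpDl.
split; apply: norm_closed_near => //; try by apply: bounded_comp => //; exact: B_bounded.
  move=> e e0; have [S [BS aS] nS] := TS _ (divr_gt0 e0 c1).
  exists (U \o S); first exact: (aS U aU).1.
  move=> x; rewrite /= -(linB _ _ lU); apply: le_trans (cU _) _.
  apply: le_trans (ler_wpM2l c0 (nS x)) _.
  rewrite mulrA ler_wpM2r ?nm_ge0 // mulrCA ger_pMr // ler_pdivrMr // mul1r.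
  by rewrite lerDl.
move=> e e0; have [S [BS aS] nS] := TS _ (divr_gt0 e0 c1).
exists (S \o U); first exact: (aS U aU).2.
move=> x /=; apply: le_trans (nS _) _.
apply: le_trans (ler_wpM2l (ltW (divr_gt0 e0 c1)) (cU x)) _.
rewrite mulrA ler_wpM2r ?nm_ge0 // -mulrA ger_pMr // mulrC ler_pdivrMr // mul1r.
by rewrite lerDl.
Qed.

Lemma rank1_bounded y z : bounded_op (rank1 y z).
Proof.
apply/bounded_opP; split=> [k a b|].
  by rewrite /rank1 hdotDl hdotZl scalerDl scalerA.
exists (nm y * nm z); first by rewrite mulr_ge0 ?nm_ge0.
move=> x; rewrite /rank1 nmZ mulrAC ler_wpM2r ?nm_ge0 // mulrC.
exact: cauchy_schwarz.
Qed.

Lemma rank1_left y : closed_subspace [set z | B (rank1 y z)].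
Proof.
split=> [z /closure_nmP zB||k z w zB wB].
- apply: norm_closed_near => // [|e e0]; first exact: rank1_bounded.
  have y1 : 0 < nm y + 1 by rewrite ltr_wpDl ?nm_ge0.
  have [w wB zw] := zB _ (divr_gt0 e0 y1); exists (rank1 y w) => // x.
  rewrite /rank1 -scalerBr nmZ.
  apply: (@le_trans _ _ (nm x * nm y * nm (z - w))).
    by rewrite ler_wpM2r ?nm_ge0 // cauchy_schwarz.
  rewrite -mulrA mulrC ler_wpM2r ?nm_ge0 //.
  apply: (@le_trans _ _ ((nm y + 1) * nm (z - w))).
    by rewrite ler_wpM2r ?nm_ge0 // lerDl.
  by rewrite -ler_pdivlMl // mulrC ltW.
- rewrite /= (_ : rank1 y 0 = 0) //.
  by apply: funext => x; rewrite /rank1 scaler0.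
- rewrite /= (_ : rank1 y (k *: z + w) = k *: rank1 y z + rank1 y w).
    exact: B_lin.
  by apply: funext => x; rewrite /rank1 scalerDr !fctE !scalerA mulrC.
Qed.

Lemma rank1_right z : closed_subspace [set y | B (rank1 y z)].
Proof.
split=> [y /closure_nmP yB||k y w yB wB].
- apply: norm_closed_near => // [|e e0]; first exact: rank1_bounded.
  have z1 : 0 < nm z + 1 by rewrite ltr_wpDl ?nm_ge0.
  have [w wB yw] := yB _ (divr_gt0 e0 z1); exists (rank1 w z) => // x.
  rewrite /rank1 -scalerBl -hdotBr nmZ.
  apply: (@le_trans _ _ (nm x * nm (y - w) * nm z)).
    by rewrite ler_wpM2r ?nm_ge0 // cauchy_schwarz.
  rewrite -mulrA mulrC ler_wpM2r ?nm_ge0 // mulrC.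
  apply: (@le_trans _ _ ((nm z + 1) * nm (y - w))).
    by rewrite ler_wpM2r ?nm_ge0 // lerDl.
  by rewrite -ler_pdivlMl // mulrC ltW.
- rewrite /= (_ : rank1 0 z = 0) //.
  by apply: funext => x; rewrite /rank1 hdot0r scale0r.
- rewrite /= (_ : rank1 (k *: y + w) z = Num.conj k *: rank1 y z + rank1 w z).
    exact: B_lin.
  by apply: funext => x; rewrite /rank1 hdotDr hdotZr scalerDl -scalerA.
Qed.

(** The value at y of the adjoint of T. *)
Lemma adjoint_vector T y : bounded_op T ->
  exists y', forall x, hdot (T x) y = hdot x y'.
Proof.
move=> /bounded_opP [lT [c c0 cT]]; apply: (@riesz _ _ _ (c * nm y)).
  by move=> k a b; rewrite lT hdotDl hdotZl.
move=> x; apply: le_trans (cauchy_schwarz _ _) _.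
by rewrite mulrAC ler_wpM2r ?nm_ge0.
Qed.

Lemma rank1_comp y z T y' : (forall x, hdot (T x) y = hdot x y') ->
  rank1 y z \o T = rank1 y' z.
Proof. by move=> Ty; apply: funext => x; rewrite /rank1 /= Ty. Qed.

Lemma orthogonal_subspace (M : set H) :
  closed_subspace [set x | forall y, M y -> hdot x y = 0].
Proof.
split=> [x /closure_nmP xM|y _|k x z xM zM y My]; last 2 first.
- by rewrite hdot0l.
- by rewrite hdotDl hdotZl xM // zM // mulr0 addr0.
move=> y My; apply/eqP; rewrite -normr_eq0 cabsE (_ : cabs _ = 0) //.
apply/eqP; rewrite eq_le cabs_ge0 andbT; apply/ler_addgt0Pr => e e0; rewrite add0r.
have y1 : 0 < nm y + 1 by rewrite ltr_wpDl ?nm_ge0.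
have [z zM xz] := xM _ (divr_gt0 e0 y1).
have -> : hdot x y = hdot (x - z) y by rewrite hdotBl zM // subr0.
apply: le_trans (cauchy_schwarz _ _) _; rewrite mulrC.
apply: (@le_trans _ _ ((nm y + 1) * nm (x - z))).
  by rewrite ler_wpM2r ?nm_ge0 // lerDl.
by rewrite -ler_pdivlMl // mulrC ltW.
Qed.

(** The admissible z, with y fixed, form a member of Lat B, which S preserves.
    For the admissible y, with z fixed, it is their orthogonal complement M that
    is a member of Lat B; since S preserves M, the adjoint of S preserves the
    closed subspace of admissible y, the orthogonal complement of M. *)
Theorem rank1_absorbed y z : B (rank1 y z) -> absorbed (rank1 y z).
Proof.
move=> Byz; split=> // S [bS iS]; split.
  have lL : lat B [set w | B (rank1 y w)].
    split; first exact: rank1_left.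
    move=> T w BT Bw; rewrite /= (_ : rank1 y (T w) = T \o rank1 y w).
      exact: B_comp.
    apply: funext => x; rewrite /rank1 /= linZ //.
    by have [] := B_bounded BT.
  have := iS _ z lL Byz; rewrite /= (_ : rank1 y (S z) = S \o rank1 y z) //.
  by apply: funext => x; rewrite /rank1 /= linZ //; have [] := bS.
pose L := [set w | B (rank1 w z)].
pose M := [set x | forall w, L w -> hdot x w = 0].
have lM : lat B M.
  split; first exact: orthogonal_subspace.
  move=> T x BT Mx w Lw; have [w' Tw] := adjoint_vector w (B_bounded BT).
  by rewrite Tw; apply: Mx; rewrite /L /= -(rank1_comp z Tw); apply: B_comp.
have [y' Sy] := adjoint_vector y bS; rewrite (rank1_comp z Sy).
have [m Lm mP] := projection y' (rank1_right z).
have Mr : M (y' - m) by exact: mP.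
have : hdot (y' - m) (y' - m) = 0.
  by rewrite hdotBr -Sy (iS M _ lM Mr) // mP // subr0.
rewrite -nm_sqr => /eqP; rewrite (fmorph_eq0 (real_complex R)) sqrf_eq0.
by move=> /eqP /nm_eq0 /eqP; rewrite subr_eq0 => /eqP ->.
Qed.

End AbsorbedOperators.

(** * Projections and matrix units *)

Section CStarFacts.
Variables (R : realType) (A : cstarAlgType R).
Implicit Types (a b c : A) (k : R[i]).

Lemma cmulDl a b c : cmul (a + b) c = cmul a c + cmul b c.
Proof. by have := cmul_linearl c 1 a b; rewrite !scale1r. Qed.

Lemma cmulDr a b c : cmul c (a + b) = cmul c a + cmul c b.
Proof. by have := cmul_linearr c 1 a b; rewrite !scale1r. Qed.

Lemma cmul0l a : cmul 0 a = 0.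
Proof. by apply: (addrI (cmul 0 a)); rewrite -cmulDl !addr0. Qed.

Lemma cmul0r a : cmul a 0 = 0.
Proof. by apply: (addrI (cmul a 0)); rewrite -cmulDr !addr0. Qed.

Lemma cmulZl k a b : cmul (k *: a) b = k *: cmul a b.
Proof. by have := cmul_linearl b k a 0; rewrite cmul0l !addr0. Qed.

Lemma cmulZr k a b : cmul a (k *: b) = k *: cmul a b.
Proof. by have := cmul_linearr a k b 0; rewrite cmul0r !addr0. Qed.

Lemma cmulBl a b c : cmul (a - b) c = cmul a c - cmul b c.
Proof. by rewrite cmulDl -scaleN1r cmulZl scaleN1r. Qed.

Lemma cmulBr a b c : cmul c (a - b) = cmul c a - cmul c b.
Proof. by rewrite cmulDr -scaleN1r cmulZr scaleN1r. Qed.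

Lemma cmul_suml (I : Type) (r : seq I) (F : I -> A) b :
  cmul (\sum_(i <- r) F i) b = \sum_(i <- r) cmul (F i) b.
Proof. by elim/big_rec2: _ => [|i y1 y2 _ <-]; rewrite ?cmul0l ?cmulDl. Qed.

Lemma cmul_sumr (I : Type) (r : seq I) (F : I -> A) b :
  cmul b (\sum_(i <- r) F i) = \sum_(i <- r) cmul b (F i).
Proof. by elim/big_rec2: _ => [|i y1 y2 _ <-]; rewrite ?cmul0r ?cmulDr. Qed.

Lemma cstar0 : cstar (0 : A) = 0.
Proof. by apply: (addrI (cstar (0 : A))); rewrite -cstarD !addr0. Qed.

Lemma cstar_sum (I : Type) (r : seq I) (F : I -> A) :
  cstar (\sum_(i <- r) F i) = \sum_(i <- r) cstar (F i).
Proof. by elim/big_rec2: _ => [|i y1 y2 _ <-]; rewrite ?cstar0 ?cstarD. Qed.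

Lemma cstarB a b : cstar (a - b) = cstar a - cstar b.
Proof. by rewrite cstarD -scaleN1r cstarZ rmorphN1 scaleN1r. Qed.

Lemma nm_cmul a b : nm (cmul a b) <= nm a * nm b.
Proof. by rewrite -lecR rmorphM /= -!nmE cnorm_mul. Qed.

Lemma nm_star a : nm (cmul (cstar a) a) = nm a ^+ 2.
Proof. by apply: complexI; rewrite rmorphXn /= -!nmE cnorm_star. Qed.

Definition orthoproj (I : eqType) (r : seq I) (d : I -> A) :=
  (forall i, i \in r -> cstar (d i) = d i /\ cmul (d i) (d i) = d i) /\
  (forall i j, i \in r -> j \in r -> i != j -> cmul (d i) (d j) = 0).

Lemma orthoproj_sqr (I : eqType) (r : seq I) (d : I -> A) (s : I -> bool) :
  uniq r -> orthoproj r d ->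
  cmul (cstar (\sum_(i <- r) (-1) ^+ s i *: d i))
    (\sum_(i <- r) (-1) ^+ s i *: d i) = \sum_(i <- r) d i.
Proof.
move=> ur [dP dO]; rewrite cstar_sum cmul_suml.
apply: eq_big_seq => i ir; rewrite cmul_sumr (bigD1_seq i) //=.
rewrite big_seq_cond big1 => [|j /andP[jr ji]].
  rewrite addr0 cstarZ rmorphXn rmorphN1 cmulZl cmulZr scalerA.
  by rewrite -signr_addb addbb scale1r (dP i ir).1 (dP i ir).2.
by rewrite cstarZ cmulZl cmulZr (dP i ir).1 dO ?scaler0 // eq_sym.
Qed.

(** For a signed sum w the product w* w is the sum p of the projections, and p is
    itself a projection, so that |w|^2 = |p| is 0 or 1. *)
Lemma orthoproj_signs (I : eqType) (r : seq I) (d : I -> A) (s : I -> bool) :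
  uniq r -> orthoproj r d -> nm (\sum_(i <- r) (-1) ^+ s i *: d i) <= 1.
Proof.
move=> ur dP; set p := \sum_(i <- r) d i.
have pp : nm p ^+ 2 = nm p.
  have e : \sum_(i <- r) (-1) ^+ xpred0 i *: d i = p.
    by apply: eq_bigr => i _; rewrite expr0 scale1r.
  by have := orthoproj_sqr xpred0 ur dP; rewrite e -nm_star => ->.
have p1 : nm p <= 1.
  have [/eqP ->//|p0] := boolP (nm p == 0).
  by move/(mulfI p0) : (etrans pp (esym (mulr1 _))) => ->.
by rewrite -(@ler_pXn2r _ 2) ?nnegrE ?nm_ge0 // expr1n -nm_star orthoproj_sqr.
Qed.

End CStarFacts.

Section MultiMatrixFacts.
Variables (R : realType) (J : finType) (n : J -> nat).
Local Notation mm := (multimx R n).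
Implicit Types (a b x : mm) (j : J).

Definition munit j (p q : 'I_(n j)) : mm :=
  mmunit R (Tagged (fun j => 'I_(n j) * 'I_(n j))%type (p, q)).

Definition mmsum (I : Type) (r : seq I) (F : I -> mm) : mm :=
  fun j => \sum_(i <- r) F i j.

Definition mm0 : mm := fun j => 0.
Definition mmscale (k : R[i]) a : mm := mmlin k a mm0.

Lemma munit_diag j p q : @munit j p q j = delta_mx p q.
Proof.
apply/matrixP => p' q'; rewrite !mxE -tag_eqE /tag_eq eqxx /=.
by rewrite tagged_asE xpair_eqE.
Qed.

Lemma munit_off j p q j' : j' != j -> @munit j p q j' = 0.
Proof.
move=> jj'; apply/matrixP => p' q'; rewrite !mxE -tag_eqE /tag_eq /=.
by rewrite (negbTE jj').
Qed.

Lemma munit_mul j p q p' q' : mmmul (@munit j p q) (@munit j p' q') =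
  if q == p' then @munit j p q' else mm0.
Proof.
apply: functional_extensionality_dep => j'; rewrite /mmmul.
have [->|jj'] := eqVneq j' j.
  rewrite !munit_diag mul_delta_mx_cond; case: eqP => _; last by rewrite mulr0n.
  by rewrite munit_diag mulr1n.
by rewrite !munit_off // mul0mx; case: ifP => // _; rewrite munit_off.
Qed.

Lemma munit_mul_off j p q j' p' q' : j != j' ->
  mmmul (@munit j p q) (@munit j' p' q') = mm0.
Proof.
move=> jj'; apply: functional_extensionality_dep => k; rewrite /mmmul.
have [->|kj] := eqVneq k j; first by rewrite (munit_off _ _ jj') mulmx0.
by rewrite (munit_off _ _ kj) mul0mx.
Qed.

Lemma munit_star j p q : mmstar (@munit j p q) = @munit j q p.
Proof.
apply: functional_extensionality_dep => j'; rewrite /mmstar.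
have [->|jj'] := eqVneq j' j; last by rewrite !munit_off // trmx0 map_mx0.
rewrite !munit_diag; apply/matrixP => k l; rewrite !mxE rmorph_nat.
by rewrite andbC.
Qed.

Lemma munit_neq0 j p q : @munit j p q <> mm0.
Proof.
move=> /(congr1 (fun a : mm => a j p q)).
rewrite munit_diag /mm0 !mxE !eqxx /= => /eqP.
by rewrite oner_eq0.
Qed.

Lemma mm_expand a :
  a = mmsum (index_enum J) (fun j => mmsum (index_enum 'I_(n j)) (fun p =>
        mmsum (index_enum 'I_(n j)) (fun q => mmscale (a j p q) (munit p q)))).
Proof.
apply: functional_extensionality_dep => k.
rewrite /mmsum (bigD1 k) //= [X in _ + X]big1 ?addr0 => [|j jk].
  rewrite [LHS]matrix_sum_delta; apply: eq_bigr => p _; apply: eq_bigr => q _.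
  by rewrite /mmscale /mmlin munit_diag addr0.
rewrite big1 // => p _; rewrite big1 // => q _.
by rewrite /mmscale /mmlin munit_off 1?eq_sym // scaler0 addr0.
Qed.

Lemma munit_corner j p a :
  mmmul (mmmul (@munit j p p) a) (@munit j p p) = mmscale (a j p p) (munit p p).
Proof.
apply: functional_extensionality_dep => k; rewrite /mmmul /mmscale /mmlin addr0.
have [->|kj] := eqVneq k j; last by rewrite !munit_off // mulmx0 scaler0.
rewrite !munit_diag; apply/matrixP => u v; rewrite mxE (bigD1 p) //= big1; last first.
  by move=> w wp; rewrite [delta_mx _ _ _ _]mxE (negbTE wp) mulr0.
rewrite addr0 mxE (bigD1 p) //= big1; last first.
  by move=> w wp; rewrite [delta_mx _ _ _ _]mxE (negbTE wp) andbF mul0r.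
rewrite !mxE !eqxx addr0 andbT /=.
by case: (u == p); case: (v == p); rewrite /= ?mul1r ?mul0r ?mulr1 ?mulr0.
Qed.

Definition mmdiag : set mm := [set a | forall j p q, p != q -> a j p q = 0].
Definition mmnonneg : set mm := [set a | forall j p q, 0 <= a j p q].

Lemma munit_mmdiag j p : mmdiag (@munit j p p).
Proof.
move=> k u v uv; have [kj|kj] := eqVneq k j; last by rewrite munit_off // mxE.
subst k; rewrite munit_diag mxE; case: eqP => //= up.
by rewrite up eq_sym in uv; rewrite (negbTE uv).
Qed.

Lemma munit_nonneg j p q : mmnonneg (@munit j p q).
Proof. by move=> k u v; rewrite mxE ler0n. Qed.

Lemma mmdiag_mulr j p a : mmdiag a ->
  mmmul a (@munit j p p) = mmscale (a j p p) (munit p p).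
Proof.
move=> da; apply: functional_extensionality_dep => k; rewrite /mmmul /mmscale /mmlin addr0.
have [->|kj] := eqVneq k j; last by rewrite !munit_off // mulmx0 scaler0.
rewrite !munit_diag; apply/matrixP => u v; rewrite mxE (bigD1 p) //= big1; last first.
  by move=> w wp; rewrite [delta_mx _ _ _ _]mxE (negbTE wp) mulr0.
rewrite addr0 !mxE eqxx /=.
have [->|up] := eqVneq u p; first by [].
by rewrite da // mul0r /= mulr0.
Qed.

Lemma mmdiag_mull j p a : mmdiag a ->
  mmmul (@munit j p p) a = mmscale (a j p p) (munit p p).
Proof.
move=> da; apply: functional_extensionality_dep => k; rewrite /mmmul /mmscale /mmlin addr0.
have [->|kj] := eqVneq k j; last by rewrite !munit_off // mul0mx scaler0.
rewrite !munit_diag; apply/matrixP => u v; rewrite mxE (bigD1 p) //= big1; last first.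
  by move=> w wp; rewrite [delta_mx _ _ _ _]mxE (negbTE wp) andbF mul0r.
rewrite addr0 !mxE eqxx andbT.
have [->|up] := eqVneq v p; first by rewrite andbT mulrC.
by rewrite (da j p v) ?mulr0 ?andbF ?mulr0 // eq_sym.
Qed.

Definition mm1 : mm := fun j => 1%:M.

Lemma mm1_sum : mm1 = mmsum (index_enum J) (fun j =>
  mmsum (index_enum 'I_(n j)) (fun p => munit p p)).
Proof.
apply: functional_extensionality_dep => k; rewrite /mmsum (bigD1 k) //=.
rewrite [X in _ + X]big1 ?addr0 => [|j jk]; last first.
  by rewrite big1 // => p _; rewrite munit_off // eq_sym.
apply/matrixP => u v; rewrite summxE mxE (bigD1 u) //= big1 => [|w wu].
  by rewrite munit_diag mxE eqxx addr0 eq_sym.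
by rewrite munit_diag mxE eq_sym (negbTE wu).
Qed.

Lemma mm1l a : mmmul mm1 a = a.
Proof. by apply: functional_extensionality_dep => k; rewrite /mmmul mul1mx. Qed.

Lemma mm1r a : mmmul a mm1 = a.
Proof. by apply: functional_extensionality_dep => k; rewrite /mmmul mulmx1. Qed.

Lemma mmdiag_upper a : mmdiag a <->
  upper_triangular a /\ upper_triangular (mmstar a).
Proof.
split=> [da|[ua usa] j p q pq].
  split=> j; apply/is_trig_mxP => p q pq; rewrite !mxE.
    by apply: da; rewrite gt_eqF.
  by rewrite da ?rmorph0 // lt_eqF.
case: (ltngtP p q) => [lt|lt|/val_inj/eqP]; last by rewrite (negbTE pq).
  have /is_trig_mxP/(_ p q lt) := usa j; rewrite !mxE => /eqP.
  by rewrite fmorph_eq0 => /eqP.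
by have /is_trig_mxP/(_ q p lt) := ua j; rewrite mxE.
Qed.

(** An off-diagonal entry of x x* is a sum of nonnegative terms, one for each
    diagonal unit; if the sum vanishes then so does every term. *)
Lemma nonneg_range_diag x j p : mmnonneg x -> mmdiag (mmmul x (mmstar x)) ->
  mmdiag (mmmul (mmmul x (@munit j p p)) (mmstar x)).
Proof.
move=> x0 dx k u v uv; have [kj|kj] := eqVneq k j; last first.
  by rewrite /mmmul munit_off // mulmx0 mul0mx mxE.
subst k; have := dx j u v uv; rewrite !mxE => /eqP.
rewrite psumr_eq0 => [/allP xx|w _]; last first.
  by rewrite !mxE mulr_ge0 // conjC_ge0.
have := xx p (mem_index_enum _) => /eqP; rewrite !mxE => xp.
rewrite /mmmul munit_diag (bigD1 p) //= big1 => [|w wp]; last first.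
  rewrite !mxE big1 ?mul0r // => z _.
  by rewrite !mxE (negbTE wp) andbF mulr0.
rewrite addr0 !mxE (bigD1 p) //= big1 => [|w wp]; last first.
  by rewrite !mxE (negbTE wp) mulr0.
by rewrite !mxE !eqxx mulr1 addr0.
Qed.

End MultiMatrixFacts.
Arguments munit {R J n j} p q.
Arguments mm0 {R J n}.
Arguments mm1 {R J n}.

Lemma mmlin_sum (R : realType) (J : finType) (n : J -> nat) (V : lmodType R[i])
    (f : multimx R n -> V) (I : Type) (r : seq I) (F : I -> multimx R n) :
  (forall k a b, f (mmlin k a b) = k *: f a + f b) ->
  f (mmsum r F) = \sum_(i <- r) f (F i).
Proof.
move=> flin; have f0 : f mm0 = 0.
  have := flin (-1) mm0 mm0; rewrite scaleN1r addNr => <-; congr f.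
  by apply: functional_extensionality_dep => j; rewrite /mmlin scaler0 addr0.
elim: r => [|i r IH].
  rewrite big_nil -[RHS]f0; congr f.
  by apply: functional_extensionality_dep => j; rewrite /mmsum big_nil.
rewrite big_cons -IH -[f (F i)]scale1r -flin; congr f.
by apply: functional_extensionality_dep => j; rewrite /mmsum /mmlin big_cons scale1r.
Qed.

(** Regularity is used only in this weaker form, which passes at once to
    composites of embeddings. *)
Lemma emb_nonneg (R : realType) (J J' : finType) (n : J -> nat)
    (n' : J' -> nat) (phi : multimx R n -> multimx R n') :
  mm_star_hom phi -> mm_regular phi ->
  forall a, mmnonneg a -> mmnonneg (phi a).
Proof.
move=> [philin _ _] phireg a a0 j' u v.
pose f b : (R[i])^o := phi b j' u v.
have flin k b c : f (mmlin k b c) = k *: f b + f c.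
  by rewrite /f philin /mmlin !mxE.
rewrite -/(f a) (mm_expand a) (mmlin_sum _ _ flin); apply: sumr_ge0 => j _.
rewrite (mmlin_sum _ _ flin); apply: sumr_ge0 => p _.
rewrite (mmlin_sum _ _ flin); apply: sumr_ge0 => q _.
have f0 : f mm0 = 0.
  have := flin (-1) mm0 mm0; rewrite scaleN1r addNr => <-; congr f.
  by apply: functional_extensionality_dep => k; rewrite /mmlin scaler0 addr0.
rewrite /mmscale flin f0 addr0; apply: mulr_ge0; first exact: a0.
have [U] := phireg (Tagged (fun j => 'I_(n j) * 'I_(n j))%type (p, q)).
rewrite /f /munit => ->.
by rewrite /mmsum_units summxE; apply: sumr_ge0 => w _; rewrite mxE ler0n.
Qed.

Lemma proj_nm_le1 (R : realType) (A : cstarAlgType R) (a : A) :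
  cstar a = a -> cmul a a = a -> nm a <= 1.
Proof.
move=> sa aa.
have [/eqP ->//|a0] := boolP (nm a == 0).
have /(mulfI a0) -> // : nm a * nm a = nm a * 1.
by rewrite -expr2 -nm_star sa aa mulr1.
Qed.

(** * The levels of the limit algebra *)

Lemma upper_triangularM (R : realType) (J : finType) (n : J -> nat)
    (a b : multimx R n) :
  upper_triangular a -> upper_triangular b -> upper_triangular (mmmul a b).
Proof.
move=> ua ub j; apply/is_trig_mxP => p q pq; rewrite !mxE big1 // => k _.
have [kq|qk] := ltnP k q.
  have /is_trig_mxP/(_ _ _ kq) := ua j; rewrite mxE => ->.
  by rewrite mul0r.
have /is_trig_mxP/(_ _ _ (leq_trans pq qk)) := ub j; rewrite mxE => ->.
by rewrite mulr0.
Qed.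

Lemma upper_triangular_lin (R : realType) (J : finType) (n : J -> nat) k
    (a b : multimx R n) :
  upper_triangular a -> upper_triangular b -> upper_triangular (mmlin k a b).
Proof.
move=> ua ub j; apply/is_trig_mxP => p q pq; rewrite !mxE.
have /is_trig_mxP/(_ _ _ pq) := ua j; rewrite mxE => ->.
have /is_trig_mxP/(_ _ _ pq) := ub j; rewrite mxE => ->.
by rewrite mulr0 addr0.
Qed.

Section Levels.
Variables (R : realType) (S : taf_system R) (AF : cstarAlgType R).
Variable psi : forall i, multimx R (@taf_size R S i) -> AF.
Hypothesis AF_limit : cstar_limit psi.
Local Notation mm i := (multimx R (@taf_size R S i)).
Implicit Types (x y t : AF).

Lemma psi_lin i k (a b : mm i) : psi (mmlin k a b) = k *: psi a + psi b.
Proof. by have [/(_ i) [+ _ _ _] _ _] := AF_limit; apply. Qed.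

Lemma psi_mul i (a b : mm i) : psi (mmmul a b) = cmul (psi a) (psi b).
Proof. by have [/(_ i) [_ + _ _] _ _] := AF_limit; apply. Qed.

Lemma psi_star i (a : mm i) : psi (mmstar a) = cstar (psi a).
Proof. by have [/(_ i) [_ _ + _] _ _] := AF_limit; apply. Qed.

Lemma psi_inj i : injective (@psi i).
Proof. by have [/(_ i) [_ _ _ +] _ _] := AF_limit; apply. Qed.

Lemma psi_emb i (a : mm i) : psi (taf_emb a) = psi a.
Proof. by have [_ + _] := AF_limit; apply. Qed.

Lemma psi_sum i (I : Type) (r : seq I) (F : I -> mm i) :
  psi (mmsum r F) = \sum_(u <- r) psi (F u).
Proof. by apply: mmlin_sum => k a b; rewrite psi_lin. Qed.

Lemma psi0 i : psi (mm0 : mm i) = 0.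
Proof.
have := psi_lin (-1) (mm0 : mm i) mm0; rewrite scaleN1r addNr => <-; congr psi.
by apply: functional_extensionality_dep => j; rewrite /mmlin scaler0 addr0.
Qed.

Lemma psi_scale i k (a : mm i) : psi (mmscale k a) = k *: psi a.
Proof. by rewrite psi_lin psi0 addr0. Qed.

Definition full_level i : set AF := range (@psi i).
Definition upper_level i : set AF := @psi i @` upper_triangular.
Definition nonneg_level i : set AF := @psi i @` @mmnonneg R _ _.
Definition diag_level i : set AF := @psi i @` @mmdiag R _ _.

Lemma level_mono (Q : forall i, set (mm i)) :
  (forall i a, Q i a -> Q i.+1 (taf_emb a)) ->
  forall i k, (i <= k)%N -> @psi i @` Q i `<=` @psi k @` Q k.
Proof.
move=> Qemb i k /subnK <-; elim: (k - i)%N => [|m IH] //.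
move=> x /IH [a Qa <-]; exists (taf_emb a); first exact: (Qemb _ a Qa).
exact: psi_emb.
Qed.

Lemma full_mono i k : (i <= k)%N -> full_level i `<=` full_level k.
Proof. exact: (@level_mono (fun i => setT)). Qed.

Lemma upp_mono i k : (i <= k)%N -> upper_level i `<=` upper_level k.
Proof.
apply: (@level_mono (fun i => @upper_triangular R _ _)) => m a; exact: taf_emb_upper.
Qed.

Lemma nonneg_mono i k : (i <= k)%N -> nonneg_level i `<=` nonneg_level k.
Proof.
apply: (@level_mono (fun i => @mmnonneg R _ _)) => m a.
by apply: emb_nonneg; [exact: taf_emb_star_hom|exact: taf_emb_regular].
Qed.

(** Diagonal means upper triangular with upper triangular adjoint, and both
    conditions are preserved by the embeddings. *)
Lemma diag_levelP i x : diag_level i x <-> upper_level i x /\ upper_level i (cstar x).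
Proof.
split=> [[a /mmdiag_upper [ua usa] <-]|[[a ua <-] [b ub]]].
  by split; [exists a|exists (mmstar a) => //; exact: psi_star].
rewrite -psi_star => /psi_inj ba; exists a => //.
by apply/mmdiag_upper; rewrite -ba.
Qed.

Lemma diag_mono i k : (i <= k)%N -> diag_level i `<=` diag_level k.
Proof.
move=> ik x /diag_levelP [ux usx]; apply/diag_levelP.
by split; apply: (upp_mono ik).
Qed.

Lemma upp_full i x : upper_level i x -> full_level i x.
Proof. by move=> [a _ <-]; exists a. Qed.

Lemma full_mul i x y : full_level i x -> full_level i y -> full_level i (cmul x y).
Proof. by move=> [a _ <-] [b _ <-]; exists (mmmul a b) => //; exact: psi_mul. Qed.

Definition level_one i : AF := @psi i mm1.

Lemma one_diag i : diag_level i (level_one i).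
Proof. by exists mm1 => // j p q pq; rewrite mxE (negbTE pq). Qed.

Lemma one_mull i x : full_level i x -> cmul (level_one i) x = x.
Proof. by move=> [a _ <-]; rewrite -psi_mul mm1l. Qed.

Lemma one_mulr i x : full_level i x -> cmul x (level_one i) = x.
Proof. by move=> [a _ <-]; rewrite -psi_mul mm1r. Qed.

(** The minimal diagonal projections of a level.  Ordered by domination, those of
    all levels form a finitely branching forest. *)
Definition node i (s : {j : taf_block S i & 'I_(taf_size j)}) : AF :=
  @psi i (munit (tagged s) (tagged s)).
Local Notation X i := ({j : taf_block S i & 'I_(taf_size j)} : finType).

Lemma one_sum i : level_one i = \sum_(s : X i) node s.
Proof.
rewrite /level_one mm1_sum psi_sum.
under eq_bigr do rewrite psi_sum.
by rewrite (sig_big_dep (fun _ => true) (fun _ _ => true)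
  (fun j (p : 'I_(taf_size j)) => psi (munit p p))).
Qed.

Lemma node_diag i (s : X i) : diag_level i (node s).
Proof. by exists (munit (tagged s) (tagged s)) => //; exact: munit_mmdiag. Qed.

Lemma node_neq0 i (s : X i) : node s <> 0.
Proof. by rewrite -(psi0 i) => /psi_inj; apply: munit_neq0. Qed.

Lemma node_star i (s : X i) : cstar (node s) = node s.
Proof. by rewrite -psi_star munit_star. Qed.

Lemma node_idem i (s : X i) : cmul (node s) (node s) = node s.
Proof. by rewrite -psi_mul munit_mul eqxx. Qed.

Lemma node_ortho i (s s' : X i) : s != s' -> cmul (node s) (node s') = 0.
Proof.
case: s s' => [j p] [j' p'] ss'; rewrite -psi_mul /=.
have [jj'|jj'] := eqVneq j j'; last by rewrite munit_mul_off // psi0.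
by subst j'; rewrite eq_Tagged /= in ss'; rewrite munit_mul (negbTE ss') psi0.
Qed.

Lemma node_corner i (s : X i) x : full_level i x ->
  exists k, cmul (cmul (node s) x) (node s) = k *: node s.
Proof.
move=> [a _ <-]; exists (a (tag s) (tagged s) (tagged s)).
by rewrite -!psi_mul munit_corner psi_scale.
Qed.

Lemma node_eigen i (s : X i) x : diag_level i x -> exists k,
  cmul x (node s) = k *: node s /\ cmul (node s) x = k *: node s.
Proof.
move=> [a da <-]; exists (a (tag s) (tagged s) (tagged s)).
by rewrite -!psi_mul mmdiag_mulr // mmdiag_mull // psi_scale.
Qed.

Lemma node_comm i (s : X i) x : diag_level i x -> cmul x (node s) = cmul (node s) x.
Proof. by move=> /(node_eigen s) [k [-> ->]]. Qed.

(** The node is an eigenvector of x, and an idempotent has no eigenvalues besides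
    0 and 1. *)
Lemma node_dichotomy i (s : X i) x : diag_level i x -> cmul x x = x ->
  cmul (node s) x = node s \/ cmul (node s) x = 0.
Proof.
move=> /(node_eigen s) [k [_ sx]] xx.
have : (k * (k - 1)) *: node s = 0.
  rewrite mulrBr mulr1 scalerBl -scalerA -sx -cmulZl -sx.
  by rewrite -cmulA xx subrr.
move=> /eqP; rewrite scaler_eq0 => /orP[|/eqP/node_neq0 //].
rewrite mulf_eq0 subr_eq0 sx => /orP[/eqP ->|/eqP ->].
  by right; rewrite scale0r.
by left; rewrite scale1r.
Qed.

(** The step of Koenig's lemma.  Below x the nodes of level i + 1 add up to a unit
    for x, so the node s must meet one of them, and then lies below it. *)
Lemma node_child i k x (s : X k) : (i < k)%N -> diag_level i x -> cmul x x = x ->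
  cmul (node s) x = node s ->
  exists s' : X i.+1, cmul (node s) (node s') = node s /\
    cmul (node s') x = node s'.
Proof.
move=> ik dx xx sx; apply: contrapT => /forallNP no.
have dx1 : diag_level i.+1 x by apply: diag_mono dx.
have kill (s' : X i.+1) : cmul (cmul (node s) (node s')) x = 0.
  have [ss'|->] := node_dichotomy s (diag_mono ik (node_diag s')) (node_idem s'); last first.
    by rewrite cmul0l.
  have [s'x|s'x] := node_dichotomy s' dx1 xx; first by case: (no s').
  by rewrite -cmulA s'x cmul0r.
apply: (@node_neq0 _ s); rewrite -sx.
have fx : full_level i.+1 x by case: dx1 => a _ <-; exists a.
rewrite -[in LHS](one_mull fx) one_sum cmul_suml cmul_sumr big1 // => s' _.
by rewrite cmulA kill.
Qed.

Section Block.
Variables (i : nat) (j : taf_block S i).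
Definition base : 'I_(taf_size j) := Ordinal (taf_size_gt0 j).
Definition level_unit (p q : 'I_(taf_size j)) : AF := psi (munit p q).
(** The part of the matrix unit (p, q) of the block selected by a projection t of
    a higher level: the corner (base, base) of t, moved to the place (p, q) by the
    units of column and row base. *)
Definition cut_unit p q t := cmul (cmul (level_unit p base) t) (level_unit base q).
(** The orbit of t under the matrix units of the block; unlike t itself, it
    commutes with level i. *)
Definition block_proj t := \sum_p cut_unit p p t.

Lemma level_unit_mul p q p' q' : cmul (level_unit p q) (level_unit p' q') =
  if q == p' then level_unit p q' else 0.
Proof. by rewrite -psi_mul munit_mul; case: ifP => // _; exact: psi0. Qed.

Lemma level_unit_star p q : cstar (level_unit p q) = level_unit q p.
Proof. by rewrite -psi_star munit_star. Qed.

Lemma level_unit_full p q : full_level i (level_unit p q).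
Proof. by exists (munit p q). Qed.

Lemma level_unit_diag p : diag_level i (level_unit p p).
Proof. by exists (munit p p) => //; exact: munit_mmdiag. Qed.

Lemma cut_unit_mul p q p' q' t t' :
  cmul (level_unit base base) t' = cmul t' (level_unit base base) ->
  cmul (cut_unit p q t) (cut_unit p' q' t') =
  if q == p' then cut_unit p q' (cmul t t') else 0.
Proof.
move=> et; rewrite /cut_unit !cmulA -(cmulA _ (level_unit base q)) level_unit_mul.
case: ifP => _; last by rewrite cmul0r !cmul0l.
rewrite -(cmulA _ _ t') et !cmulA -(cmulA _ (level_unit base base)) level_unit_mul eqxx.
by rewrite -(cmulA _ t t').
Qed.

Lemma cut_unit_star p q t : cstar t = t -> cstar (cut_unit p q t) = cut_unit q p t.
Proof. by move=> st; rewrite /cut_unit !cstarM !level_unit_star st cmulA. Qed.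

Lemma cut_unit_sum p q (I : Type) (r : seq I) (F : I -> AF) :
  \sum_(u <- r) cut_unit p q (F u) = cut_unit p q (\sum_(u <- r) F u).
Proof. by rewrite /cut_unit cmul_sumr cmul_suml. Qed.

Lemma cut_unit_one k p q : (i <= k)%N -> cut_unit p q (level_one k) = level_unit p q.
Proof.
move=> ik; rewrite /cut_unit one_mulr; last exact: (full_mono ik (level_unit_full _ _)).
by rewrite level_unit_mul eqxx.
Qed.

(** Let x be the unit (p, base) seen at level k.  Its entries are nonnegative and
    x x* is diagonal, hence x t x* is diagonal for each diagonal unit t. *)
Lemma cut_unit_diag k p (s : X k) : (i <= k)%N ->
  diag_level k (cut_unit p p (node s)).
Proof.
move=> ik; have [x x0 ex] : nonneg_level k (level_unit p base).
  apply: (nonneg_mono ik); exists (munit p base) => //; exact: munit_nonneg.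
have [y dy ey] := diag_mono ik (level_unit_diag p).
have xy : y = mmmul x (mmstar x).
  apply: (@psi_inj k); rewrite psi_mul psi_star ex ey level_unit_star level_unit_mul.
  by rewrite eqxx.
exists (mmmul (mmmul x (munit (tagged s) (tagged s))) (mmstar x)).
  by apply: nonneg_range_diag => //; rewrite -xy.
by rewrite !psi_mul psi_star ex level_unit_star.
Qed.

(** Conjugation by the units brings the corner of level k at cut_unit p p back to
    the corner at the node, which is one-dimensional. *)
Lemma cut_unit_corner k p (s : X k) x : (i <= k)%N -> full_level k x ->
  exists c, cmul (cmul (cut_unit p p (node s)) x) (cut_unit p p (node s)) =
    c *: cut_unit p p (node s).
Proof.
move=> ik fx; have fe p1 q1 : full_level k (level_unit p1 q1).
  exact: (full_mono ik (level_unit_full _ _)).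
have [c cE] := node_corner s (full_mul (full_mul (fe base p) fx) (fe p base)).
exists c; rewrite /cut_unit -cmulZl -cmulZr -cE.
by rewrite !cmulA.
Qed.

Lemma block_proj_mul t t' : cmul (level_unit base base) t' = cmul t' (level_unit base base) ->
  cmul (block_proj t) (block_proj t') = block_proj (cmul t t').
Proof.
move=> et; rewrite /block_proj cmul_suml; apply: eq_bigr => p _.
rewrite cmul_sumr (bigD1 p) //= big1 => [|q qp].
  by rewrite cut_unit_mul // eqxx addr0.
by rewrite cut_unit_mul // eq_sym (negbTE qp).
Qed.

Lemma block_proj_star t : cstar t = t -> cstar (block_proj t) = block_proj t.
Proof. by move=> st; rewrite /block_proj cstar_sum; apply: eq_bigr => p _; rewrite cut_unit_star. Qed.

Lemma block_proj0 : block_proj 0 = 0.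
Proof. by rewrite /block_proj big1 // => p _; rewrite /cut_unit cmul0r cmul0l. Qed.

Lemma block_proj_eunitl p q t : cmul (block_proj t) (level_unit p q) = cut_unit p q t.
Proof.
rewrite /block_proj cmul_suml (bigD1 p) //= big1 => [|u up].
  by rewrite addr0 /cut_unit -cmulA level_unit_mul eqxx.
by rewrite /cut_unit -cmulA level_unit_mul (negbTE up) cmul0r.
Qed.

Lemma block_proj_eunitr p q t : cmul (level_unit p q) (block_proj t) = cut_unit p q t.
Proof.
rewrite /block_proj cmul_sumr (bigD1 q) //= big1 => [|u uq].
  by rewrite addr0 /cut_unit !cmulA level_unit_mul eqxx.
by rewrite /cut_unit !cmulA level_unit_mul eq_sym (negbTE uq) !cmul0l.
Qed.

End Block.

Lemma level_unit_off i (j j' : taf_block S i) p q p' q' : j != j' ->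
  cmul (@level_unit i j p q) (@level_unit i j' p' q') = 0.
Proof. by move=> jj'; rewrite -psi_mul munit_mul_off // psi0. Qed.

Lemma block_proj_off i (j j' : taf_block S i) t t' : j != j' ->
  cmul (block_proj j t) (block_proj j' t') = 0.
Proof.
move=> jj'; rewrite /block_proj cmul_suml big1 // => p _; rewrite cmul_sumr big1 // => q _.
by rewrite /cut_unit !cmulA -(cmulA _ (level_unit _ _) (level_unit _ _)) level_unit_off // cmul0r !cmul0l.
Qed.

Lemma block_proj_off_eunit i (j j' : taf_block S i) t p q : j != j' ->
  cmul (block_proj j t) (@level_unit i j' p q) = 0 /\ cmul (@level_unit i j' p q) (block_proj j t) = 0.
Proof.
move=> jj'; rewrite /block_proj cmul_suml cmul_sumr; split.
  by apply: big1 => u _; rewrite /cut_unit -cmulA level_unit_off // cmul0r.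
by apply: big1 => u _; rewrite /cut_unit !cmulA level_unit_off 1?eq_sym // !cmul0l.
Qed.

Lemma block_proj_comm i (j : taf_block S i) t a : full_level i a ->
  cmul (block_proj j t) a = cmul a (block_proj j t).
Proof.
move=> [m _ <-]; rewrite [m]mm_expand psi_sum cmul_suml cmul_sumr.
apply: eq_bigr => j' _; rewrite psi_sum cmul_suml cmul_sumr.
apply: eq_bigr => p _; rewrite psi_sum cmul_suml cmul_sumr.
apply: eq_bigr => q _; rewrite psi_scale cmulZl cmulZr; congr (_ *: _).
have [jj'|jj'] := eqVneq j j'.
  by subst j'; rewrite -/(level_unit p q) block_proj_eunitl block_proj_eunitr.
by have [-> ->] := block_proj_off_eunit t p q jj'.
Qed.

Definition cell i k (u : taf_block S i * X k) : AF := block_proj u.1 (node u.2).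

Lemma cell_sum i k : (i <= k)%N -> \sum_u @cell i k u = level_one i.
Proof.
move=> ik; rewrite /cell -(pair_bigA _ (fun j s => block_proj j (node s))) /=.
rewrite /level_one mm1_sum psi_sum; apply: eq_bigr => j _.
rewrite psi_sum exchange_big /=; apply: eq_bigr => p _.
by rewrite cut_unit_sum -one_sum cut_unit_one.
Qed.

Lemma base_node i k (j : taf_block S i) (s : X k) : (i <= k)%N ->
  cmul (level_unit (base j) (base j)) (node s) = cmul (node s) (level_unit (base j) (base j)).
Proof. by move=> ik; apply: node_comm; apply: (diag_mono ik (level_unit_diag _)). Qed.

Lemma cell_orthoproj i k : (i <= k)%N -> orthoproj (index_enum _) (@cell i k).
Proof.
move=> ik; split=> [u _|[j s] [j' s'] _ _].
  split; first by rewrite /cell block_proj_star // node_star.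
  by rewrite /cell block_proj_mul ?node_idem //; apply: base_node.
rewrite /cell /= xpair_eqE negb_and; have [->|jj'] := eqVneq j j' => /= [ss'|_].
  by rewrite block_proj_mul ?base_node // node_ortho // block_proj0.
exact: block_proj_off.
Qed.

(** Pinching by the orbits does not change level i. *)
Lemma cell_pinch i k a : (i <= k)%N -> full_level i a ->
  \sum_u cmul (cmul (@cell i k u) a) (@cell i k u) = a.
Proof.
move=> ik fa; rewrite -[RHS](one_mull fa) -(cell_sum ik) cmul_suml.
apply: eq_bigr => u _; rewrite -cmulA -block_proj_comm // cmulA.
by rewrite ((cell_orthoproj ik).1 u (mem_index_enum _)).2.
Qed.

Lemma block_proj_upp i k (j : taf_block S i) (s : X k) : (i <= k)%N ->
  upper_level k (block_proj j (node s)).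
Proof.
move=> ik.
have hu (p : 'I_(taf_size j)) : upper_level k (cut_unit p p (node s)).
  by have [] := (diag_levelP _ _).1 (cut_unit_diag p s ik).
rewrite /block_proj; elim/big_rec: _ => [|p y _ [b ub <-]].
  exists mm0; last exact: psi0.
  by move=> l; apply/is_trig_mxP => *; rewrite !mxE.
have [a ua ea] := hu p; exists (mmlin 1 a b); first exact: upper_triangular_lin.
by rewrite psi_lin scale1r ea.
Qed.

Local Notation A := (taf_algebra psi).

Lemma upp_taf i : upper_level i `<=` A.
Proof. by move=> x ux; apply: subset_closure; exists i. Qed.

Lemma tafP x : A x <-> forall e : R, 0 < e ->
  exists i, exists2 a, upper_level i a & nm (x - a) < e.
Proof.
split=> [/closure_nmP xA e /xA [a [i _ ua] xa]|xA]; first by exists i, a.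
apply/closure_nmP => e /xA [i [a ua xa]]; exists a => //; by exists i.
Qed.

Lemma taf_lin k x y : A x -> A y -> A (k *: x + y).
Proof.
move=> /tafP Ax /tafP Ay; apply/tafP => e e0.
have k0 : 0 < cabs k + 1 by rewrite ltr_wpDl ?cabs_ge0.
have [i [a ua xa]] := Ax _ (divr_gt0 e0 (mulr_gt0 k0 (ltr0n R 2))).
have [l [b ub yb]] := Ay _ (divr_gt0 e0 (ltr0n R 2)).
have [a' ua' ea] := upp_mono (leq_maxl i l) ua.
have [b' ub' eb] := upp_mono (leq_maxr i l) ub.
exists (maxn i l), (k *: a + b).
  exists (mmlin k a' b'); first exact: upper_triangular_lin.
  by rewrite psi_lin ea eb.
rewrite opprD addrACA -scalerBr; apply: le_lt_trans (nmD _ _) _.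
rewrite nmZ (splitr e); apply: ler_ltD => //.
apply: (@le_trans _ _ ((cabs k + 1) * nm (x - a))).
  by rewrite ler_wpM2r ?nm_ge0 // lerDl.
by rewrite -ler_pdivlMl //; apply: le_trans (ltW xa) _; rewrite invfM mulrCA.
Qed.

Lemma taf_mul x y : A x -> A y -> A (cmul x y).
Proof.
move=> /tafP Ax /tafP Ay; apply/tafP => e e0.
have x0 : 0 < nm x + 1 by rewrite ltr_wpDl ?nm_ge0.
have [l [b ub yb]] := Ay _ (divr_gt0 e0 (mulr_gt0 x0 (ltr0n R 2))).
have b0 : 0 < nm b + 1 by rewrite ltr_wpDl ?nm_ge0.
have [i [a ua xa]] := Ax _ (divr_gt0 e0 (mulr_gt0 b0 (ltr0n R 2))).
have [a' ua' ea] := upp_mono (leq_maxl i l) ua.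
have [b' ub' eb] := upp_mono (leq_maxr i l) ub.
exists (maxn i l), (cmul a b).
  exists (mmmul a' b'); first exact: upper_triangularM.
  by rewrite psi_mul ea eb.
have -> : cmul x y - cmul a b = cmul x (y - b) + cmul (x - a) b.
  by rewrite cmulBr cmulBl addrA subrK.
apply: le_lt_trans (nmD _ _) _; rewrite (splitr e).
have half (u v : R) : 0 <= u -> 0 <= v -> v < e / ((u + 1) * 2) -> u * v < e / 2.
  move=> u0 v0 lt; have u1 : 0 < u + 1 by rewrite ltr_wpDl.
  apply: (@le_lt_trans _ _ ((u + 1) * v)); first by rewrite ler_wpM2r // lerDl.
  by rewrite -ltr_pdivlMl //; apply: lt_le_trans lt _; rewrite invfM mulrCA.
apply: ltrD.
  by apply: le_lt_trans (nm_cmul _ _) _; apply: half; rewrite ?nm_ge0.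
by apply: le_lt_trans (nm_cmul _ _) _; rewrite mulrC; apply: half; rewrite ?nm_ge0.
Qed.

Lemma taf0 : A 0.
Proof.
apply: (upp_taf (i := 0%N)); exists mm0; last exact: psi0.
by move=> l; apply/is_trig_mxP => *; rewrite !mxE.
Qed.

Lemma taf_sum (I : Type) (r : seq I) (F : I -> AF) :
  (forall u, A (F u)) -> A (\sum_(u <- r) F u).
Proof.
move=> AF'; elim/big_rec: _ => [|u y _ Ay]; first exact: taf0.
by rewrite -[F u]scale1r; apply: taf_lin.
Qed.

Lemma taf_scale k x : A x -> A (k *: x).
Proof. by move=> Ax; rewrite -[_ *: _]addr0; apply: taf_lin => //; exact: taf0. Qed.

End Levels.

(** * Compact operators in the range of a nest representation *)

(** With dependent_chain, this is Koenig's lemma: among finitely many successors,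
    one is above bad nodes of arbitrarily high level. *)
Lemma inf_pigeon (K : finType) (P : K -> nat -> Prop) :
  (forall N, exists k, (N <= k)%N /\ exists u, P u k) ->
  exists u, forall N, exists k, (N <= k)%N /\ P u k.
Proof.
move=> infP; apply: contrapT => /forallNP no.
have {no} [M MP] : exists M : K -> nat, forall u k, (M u <= k)%N -> ~ P u k.
  suff : forall u, exists N, forall k, (N <= k)%N -> ~ P u k.
    by move=> /choice [M MP]; exists M.
  move=> u; have /existsNP [N NP] := no u; exists N => k Nk Puk.
  by apply: NP; exists k.
have [k [Mk [u Puk]]] := infP (\max_u M u).
by apply: (MP u k) => //; apply: leq_trans Mk; apply: leq_bigmax.
Qed.

Lemma dependent_chain (T : Type) (G : nat -> T -> Prop)
    (E : nat -> T -> T -> Prop) x0 : G 0%N x0 ->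
  (forall n x, G n x -> exists y, G n.+1 y /\ E n x y) ->
  exists f : nat -> T, forall n, G n (f n) /\ E n (f n) (f n.+1).
Proof.
move=> G0 step.
pose next n (x : {x | G n x}) := cid (step n (sval x) (svalP x)).
pose F := fix F n : {x | G n x} := if n is n'.+1 return {x | G n x}
  then exist (G n'.+1) (sval (next n' (F n'))) (svalP (next n' (F n'))).1
  else exist (G 0%N) x0 G0.
exists (fun n => sval (F n)) => n; split; first exact: svalP (F n).
exact: (svalP (next n (F n))).2.
Qed.

Section Representation.
Variables (R : realType) (S : taf_system R) (AF : cstarAlgType R).
Variable psi : forall i, multimx R (@taf_size R S i) -> AF.
Hypothesis AF_limit : cstar_limit psi.
Variables (H : hilbertType R) (rho : AF -> H -> H).
Hypothesis rho_nest : nest_representation (taf_algebra psi) rho.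
Hypothesis rho_closed : norm_closed (rho @` taf_algebra psi).
Local Notation A := (taf_algebra psi).
Local Notation B := (rho @` taf_algebra psi).
Local Notation X i := ({j : taf_block S i & 'I_(taf_size j)} : finType).
Implicit Types (a b : AF) (x y z v w : H).

Lemma rho_bounded a : A a -> bounded_op (rho a).
Proof. by have [[+ _ _ _] _] := rho_nest; apply. Qed.

Lemma rho_linear a : A a -> linear (rho a).
Proof. by move=> /rho_bounded []. Qed.

Lemma rho_lin k a b x : A a -> A b -> rho (k *: a + b) x = k *: rho a x + rho b x.
Proof. by move=> Aa Ab; have [[_ + _ _] _] := rho_nest => /(_ k a b Aa Ab) ->. Qed.

Lemma rho_mul a b x : A a -> A b -> rho (cmul a b) x = rho a (rho b x).
Proof. by move=> Aa Ab; have [[_ _ + _] _] := rho_nest => /(_ a b Aa Ab) ->. Qed.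

Lemma rho_bound : exists2 C : R, 0 <= C &
  forall a x, A a -> nm (rho a x) <= C * nm a * nm x.
Proof.
have [[_ _ _ [c cP]] _] := rho_nest; exists `|c| => // a x Aa.
apply: le_trans (opnorm_bound x (rho_bounded Aa)) _.
rewrite ler_wpM2r ?nm_ge0 //; have := cP a Aa.
rewrite nmE -rmorphM /= lecR => /le_trans; apply.
by rewrite ler_wpM2r ?nm_ge0 // ler_norm.
Qed.

Lemma rho0 x : rho 0 x = 0.
Proof.
have := rho_lin 1 x (taf0 AF_limit) (taf0 AF_limit).
by rewrite scaler0 addr0 scale1r => /(congr1 (fun y => y - rho 0 x)); rewrite subrr addrK.
Qed.

Lemma rhoZ k a x : A a -> rho (k *: a) x = k *: rho a x.
Proof.
by move=> Aa; have := rho_lin k x Aa (taf0 AF_limit); rewrite rho0 !addr0.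
Qed.

Lemma rhoB a b x : A a -> A b -> rho (a - b) x = rho a x - rho b x.
Proof.
by move=> Aa Ab; rewrite addrC -scaleN1r rho_lin // scaleN1r addrC.
Qed.

Lemma rho_sum (I : Type) (r : seq I) (F : I -> AF) x : (forall u, A (F u)) ->
  rho (\sum_(u <- r) F u) x = \sum_(u <- r) rho (F u) x.
Proof.
move=> AF'; elim: r => [|u r IH]; first by rewrite !big_nil rho0.
rewrite !big_cons -IH -[F u in LHS]scale1r rho_lin ?scale1r //.
exact: taf_sum.
Qed.

Lemma B_bounded T : B T -> bounded_op T.
Proof. by move=> [a Aa <-]; apply: rho_bounded. Qed.

Lemma B_lin (k : R[i]) T1 T2 : B T1 -> B T2 -> B (k *: T1 + T2).
Proof.
move=> [a Aa <-] [b Ab <-]; exists (k *: a + b); first exact: taf_lin.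
by apply: funext => x; rewrite rho_lin.
Qed.

Lemma B_comp T1 T2 : B T1 -> B T2 -> B (T1 \o T2).
Proof.
move=> [a Aa <-] [b Ab <-]; exists (cmul a b); first exact: taf_mul.
by apply: funext => x; rewrite rho_mul.
Qed.

Lemma B_0 : B 0.
Proof. by exists 0; [exact: taf0|apply: funext => x; rewrite rho0]. Qed.

Section Bound.
Variable C : R.
Hypothesis C0 : 0 <= C.
Hypothesis rhoC : forall a x, A a -> nm (rho a x) <= C * nm a * nm x.

Lemma rho_contr a x : A a -> nm a <= 1 -> nm (rho a x) <= C * nm x.
Proof.
move=> Aa a1; apply: le_trans (rhoC x Aa) _.
by rewrite ler_wpM2r ?nm_ge0 // ler_piMr.
Qed.

Section OrthogonalFamily.
Variables (I : eqType) (r : seq I) (d : I -> AF).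
Hypothesis ur : uniq r.
Hypothesis dA : forall u, A (d u).
Hypothesis dP : orthoproj r d.

Let sgn (s : I -> bool) := \sum_(u <- r) (-1) ^+ s u *: d u.

Let sgnA s : A (sgn s).
Proof. by apply: taf_sum => // u; apply: taf_scale. Qed.

Let rho_sgn s x : rho (sgn s) x = \sum_(u <- r) (-1) ^+ s u *: rho (d u) x.
Proof.
rewrite rho_sum; first by apply: eq_bigr => u _; rewrite rhoZ.
by move=> u; apply: taf_scale.
Qed.

(** Signed sums of the projections have norm at most 1; together with
    greedy_signs this makes the norm of H equivalent, on the range of the family,
    to the l2 norm of the components, with constants depending on rho alone. *)
Lemma square_sum_upper x :
  \sum_(u <- r) nm (rho (d u) x) ^+ 2 <= (C * nm x) ^+ 2.
Proof.
apply: square_sum_le => // s; rewrite -rho_sgn.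
by apply: rho_contr => //; apply: orthoproj_signs.
Qed.

Lemma square_sum_lower x :
  nm (\sum_(u <- r) rho (d u) x) ^+ 2 <=
  C ^+ 2 * \sum_(u <- r) nm (rho (d u) x) ^+ 2.
Proof.
have [_ [s hs]] := greedy_signs (fun u => rho (d u) x) ur.
have -> : \sum_(u <- r) rho (d u) x = rho (sgn s) (rho (sgn s) x).
  rewrite -rho_sum // -rho_mul // -(orthoproj_sqr s ur dP); congr (rho (cmul _ _) _).
  rewrite cstar_sum; apply: eq_big_seq => u ru.
  by rewrite cstarZ rmorphXn rmorphN1 (dP.1 u ru).1.
rewrite -rho_sgn in hs.
apply: (@le_trans _ _ ((C * nm (rho (sgn s) x)) ^+ 2)).
  rewrite ler_pXn2r ?nnegrE ?nm_ge0 ?mulr_ge0 ?nm_ge0 //.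
  by apply: rho_contr => //; apply: orthoproj_signs.
by rewrite exprMn ler_wpM2l // sqr_ge0.
Qed.

(** For truly orthogonal projections the bound would be m; the two uses of the
    square function cost a factor C each. *)
Lemma block_diagonal_bound (W : I -> H -> H) (m : R) x : 0 <= m ->
  (forall u y, nm (rho (d u) (W u y)) <= m * nm y) ->
  nm (\sum_(u <- r) rho (d u) (W u (rho (d u) x))) <= C * (m * (C * nm x)).
Proof.
move=> m0 Wm; pose y := \sum_(u <- r) rho (d u) (W u (rho (d u) x)).
have dy u : u \in r -> rho (d u) y = rho (d u) (W u (rho (d u) x)).
  move=> ru; rewrite /y lin_sum; last exact: rho_linear.
  rewrite (bigD1_seq u) //= big_seq_cond big1 => [|u' /andP[ru' uu']].
    by rewrite -rho_mul // (dP.1 u ru).2 addr0.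
  by rewrite -rho_mul // dP.2 ?rho0 // eq_sym.
have yE : y = \sum_(u <- r) rho (d u) y.
  by rewrite {1}/y; apply: eq_big_seq => u ru; rewrite dy.
rewrite -/y -(@ler_pXn2r _ 2) ?nnegrE ?nm_ge0 ?mulr_ge0 ?nm_ge0 //.
rewrite {1}yE; apply: le_trans (square_sum_lower _) _.
rewrite [leRHS]exprMn ler_wpM2l ?sqr_ge0 // [leRHS]exprMn.
apply: le_trans (ler_wpM2l (sqr_ge0 m) (square_sum_upper x)).
rewrite mulr_sumr big_seq [leRHS]big_seq; apply: ler_sum => u ru.
by rewrite dy // -exprMn ler_pXn2r ?nnegrE ?nm_ge0 ?mulr_ge0 ?nm_ge0.
Qed.

End OrthogonalFamily.

Definition decreasing_proj (g : nat -> AF) :=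
  [/\ forall n, A (g n), forall n, cstar (g n) = g n &
      forall m n, (m <= n)%N -> cmul (g n) (g m) = g n /\ cmul (g m) (g n) = g n].

Lemma decreasing_orthoproj g (k : nat -> nat) (r : seq nat) :
  decreasing_proj g -> {homo k : u v / (u <= v)%N} ->
  orthoproj r (fun u => g (k u) - g (k u.+1)).
Proof.
move=> [_ gs gm] km.
have kS u : (k u <= k u.+1)%N by apply: km.
split=> [u _|u v _ _].
  rewrite cstarB !gs cmulBl !cmulBr (gm _ _ (leqnn (k u))).1.
  rewrite (gm _ _ (kS u)).1 (gm _ _ (kS u)).2 (gm _ _ (leqnn _)).1.
  by rewrite subrr subr0.
rewrite neq_ltn cmulBl !cmulBr => /orP[uv|vu].
  have le1 : (k u.+1 <= k v)%N by apply: km.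
  have le2 : (k u.+1 <= k v.+1)%N by apply: leq_trans le1 _.
  have le3 : (k u <= k v)%N by apply: km; exact: ltnW.
  have le4 : (k u <= k v.+1)%N by apply: leq_trans le3 _.
  by rewrite (gm _ _ le1).2 (gm _ _ le2).2 (gm _ _ le3).2 (gm _ _ le4).2 subrr.
have le1 : (k v.+1 <= k u)%N by apply: km.
have le2 : (k v.+1 <= k u.+1)%N by apply: leq_trans le1 _.
have le3 : (k v <= k u)%N by apply: km; exact: ltnW.
have le4 : (k v <= k u.+1)%N by apply: leq_trans le3 _.
by rewrite (gm _ _ le1).1 (gm _ _ le2).1 (gm _ _ le3).1 (gm _ _ le4).1 !subrr.
Qed.

Lemma variation_bound g (k : nat -> nat) m (s : nat -> bool) x :
  decreasing_proj g -> {homo k : u v / (u <= v)%N} ->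
  nm (rho (\sum_(u <- iota 0 m) (-1) ^+ s u *: (g (k u) - g (k u.+1))) x)
    <= C * nm x.
Proof.
move=> dg km; have [gA _ _] := dg.
apply: rho_contr; last first.
  by apply: orthoproj_signs; [exact: iota_uniq|exact: decreasing_orthoproj].
apply: taf_sum => // u; apply: taf_scale => //.
by rewrite addrC -scaleN1r; apply: taf_lin.
Qed.

Lemma rho_variation g (k : nat -> nat) m (s : nat -> bool) x :
  decreasing_proj g ->
  rho (\sum_(u <- iota 0 m) (-1) ^+ s u *: (g (k u) - g (k u.+1))) x =
  \sum_(u <- iota 0 m) (-1) ^+ s u *: (rho (g (k u)) x - rho (g (k u.+1)) x).
Proof.
move=> [gA _ _].
have gB u : A (g (k u) - g (k u.+1)).
  by rewrite addrC -scaleN1r; apply: taf_lin.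
rewrite rho_sum; first by apply: eq_bigr => u _; rewrite rhoZ // rhoB.
by move=> u; apply: taf_scale.
Qed.

(** The successive differences of the g n are orthogonal projections, so signed
    sums of increments are bounded. *)
Lemma decreasing_cvg g x : decreasing_proj g ->
  exists l, nm_cvg (fun n => rho (g n) x) l.
Proof.
move=> dg; apply: nm_cauchy_cvg; apply: (cauchy_of_bounded_variation (B := C * nm x)).
move=> k m s km; rewrite -rho_variation //; exact: variation_bound.
Qed.

(** The analogue of decreasing_cvg for the adjoints: y n represents the functional
    x |-> <T (rho (g n) x), w>. *)
Lemma decreasing_adjoint_cvg g T w (y : nat -> H) : decreasing_proj g ->
  bounded_op T -> (forall n x, hdot (T (rho (g n) x)) w = hdot x (y n)) ->
  exists l, nm_cvg y l.
Proof.
move=> dg bT yP; apply: nm_cauchy_cvg.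
have /bounded_opP [lT [c c0 cT]] := bT.
apply: (cauchy_of_bounded_variation (B := c * C * nm w)) => k m s km.
set z := \sum_(i <- _) _.
have zz : hdot z z = hdot (T (rho (\sum_(u <- iota 0 m)
    (-1) ^+ s u *: (g (k u) - g (k u.+1))) z)) w.
  rewrite rho_variation // (lin_sum _ _ lT) hdot_suml.
  rewrite [in hdot z]/z hdot_sumr; apply: eq_bigr => u _.
  rewrite (linZ _ _ lT) (linB _ _ lT) hdotZl hdotBl !yP hdotZr hdotBr.
  by rewrite rmorphXn rmorphN1.
have [/eqP z0|z0] := boolP (nm z == 0).
  by rewrite z0 !mulr_ge0 ?nm_ge0.
have z0' : 0 < nm z by rewrite lt_def z0 nm_ge0.
rewrite -(ler_pM2r z0') -expr2.
have -> : nm z ^+ 2 = cabs (hdot z z) by rewrite -nm_sqr cabs_real // sqr_ge0.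
rewrite zz; apply: le_trans (cauchy_schwarz _ _) _.
rewrite mulrAC ler_wpM2r ?nm_ge0 //.
apply: le_trans (cT _) _; rewrite -mulrA ler_wpM2l //.
exact: variation_bound.
Qed.

Section Corner.
Variable g : nat -> AF.
Hypothesis dg : decreasing_proj g.

(** The range of the strong limit of the rho (g n). *)
Definition fixed_space : set H := [set v | forall n, rho (g n) v = v].

Let gA n : A (g n). Proof. by have [+ _ _] := dg. Qed.

Lemma decreasing_nm_le1 n : nm (g n) <= 1.
Proof.
have [_ gs gm] := dg; apply: proj_nm_le1; first exact: gs.
exact: (gm n n (leqnn n)).1.
Qed.

Definition cyclic v : set H :=
  [set y | forall e : R, 0 < e -> exists2 a, A a & nm (y - rho a v) < e].

Lemma cyclic_lat v : lat B (cyclic v).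
Proof.
split; first split.
- move=> y /closure_nmP yM e e0; have e2 : 0 < e / 2 by rewrite divr_gt0.
  have [z zM yz] := yM _ e2; have [a Aa za] := zM _ e2; exists a => //.
  by apply: le_lt_trans (nm_tri z _ _) _; rewrite [ltRHS]splitr ltrD.
- move=> e e0; exists 0; first exact: taf0.
  by rewrite rho0 subr0 nm0.
- move=> k y z yM zM e e0; have e2 : 0 < e / 2 by rewrite divr_gt0.
  have [d d0 dP] := small_factor (cabs_ge0 k) e2.
  have [a Aa ya] := yM _ d0; have [b Ab zb] := zM _ e2.
  exists (k *: a + b); first exact: taf_lin.
  rewrite rho_lin // opprD addrACA -scalerBr; apply: le_lt_trans (nmD _ _) _.
  rewrite nmZ [ltRHS]splitr; apply: ler_ltD => //; apply: le_trans dP.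
  by rewrite ler_wpM2l ?cabs_ge0 // ltW.
move=> T y [b Ab <-] yM e e0.
have Cb : 0 <= C * nm b by rewrite mulr_ge0 ?nm_ge0.
have e2 : 0 < e / 2 by rewrite divr_gt0.
have [d d0 dP] := small_factor Cb e2; have [a Aa ya] := yM _ d0.
exists (cmul b a); first exact: taf_mul.
rewrite rho_mul // -(linB _ _ (rho_linear Ab)); apply: le_lt_trans (rhoC _ Ab) _.
apply: (@le_lt_trans _ _ (e / 2)); last by rewrite gtr_pMr // invf_lt1 // ltr1n.
by apply: le_trans dP; rewrite ler_wpM2l // ltW.
Qed.

Section FixedSpace.
Hypothesis g_corner : forall i b, upper_level psi i b -> exists N, forall n, (N <= n)%N ->
  exists c, cmul (cmul (g n) b) (g n) = c *: g n.

(** If rho b v is close to w, with b in some level, then so is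
    rho (g n) (rho b v) = rho (g n b g n) v, a multiple of v for large n. *)
Lemma fixed_in_cyclic v w : fixed_space v -> fixed_space w -> cyclic v w ->
  exists k, w = k *: v.
Proof.
move=> Vv Vw wM; apply: line_limit => e e0.
have e2 : 0 < e / 2 by rewrite divr_gt0.
have [d d0 dP] := small_factor C0 e2.
have d2 : 0 < d / 2 by rewrite divr_gt0.
have [a Aa wa] := wM _ d2.
have Cv : 0 <= C * nm v by rewrite mulr_ge0 ?nm_ge0.
have [d' d'0 d'P] := small_factor Cv d2.
have [i [b ub ab]] := (tafP _ _).1 Aa _ d'0.
have Ab : A b by exact: upp_taf ub.
have [N NP] := g_corner ub; have [c cE] := NP N (leqnn N).
have gbg : rho (g N) (rho b v) = c *: v.
  transitivity (rho (cmul (cmul (g N) b) (g N)) v).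
    by rewrite !rho_mul ?Vv //; apply: taf_mul.
  by rewrite cE rhoZ // Vv.
exists c; have -> : w - c *: v = rho (g N) (w - rho b v).
  by rewrite (linB _ _ (rho_linear (@gA N))) Vw gbg.
apply: (@le_lt_trans _ _ (e / 2)); last by rewrite gtr_pMr // invf_lt1 // ltr1n.
apply: le_trans (rho_contr _ (@gA N) (decreasing_nm_le1 N)) _.
apply: le_trans dP; rewrite ler_wpM2l //.
apply: le_trans (nm_tri (rho a v) _ _) _; rewrite [leRHS]splitr lerD ?(ltW wa) //.
rewrite -rhoB //; apply: le_trans d'P; rewrite mulrAC.
apply: le_trans (rhoC _ _) _.
  by rewrite addrC -scaleN1r; apply: taf_lin.
by rewrite ler_wpM2r ?nm_ge0 // ler_wpM2l // ltW.
Qed.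

Lemma fixed_self v : fixed_space v -> cyclic v v.
Proof.
move=> Vv e e0; exists (g 0%N) => //.
by rewrite Vv subrr nm0.
Qed.

(** The only use of the linear order of the lattice: of two cyclic subspaces one
    contains the other. *)
Lemma fixed_space_line :
  exists2 v, fixed_space v & forall w, fixed_space w -> exists k, w = k *: v.
Proof.
have V0 : fixed_space 0 by move=> n; rewrite (lin0 (rho_linear (@gA n))).
have [[v [Vv v0]]|no] := pselect (exists v, fixed_space v /\ v <> 0); last first.
  exists 0 => // w Vw; exists 0; rewrite scaler0; apply: contrapT => w0.
  by apply: no; exists w.
exists v => // w Vw.
have [_ /(_ _ _ (cyclic_lat v) (cyclic_lat w)) [vw|wv]] := rho_nest; last first.
  by apply: fixed_in_cyclic => //; apply: wv; exact: fixed_self.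
have [k vk] : exists k, v = k *: w.
  by apply: fixed_in_cyclic => //; apply: vw; exact: fixed_self.
exists k^-1; rewrite vk scalerA mulVf ?scale1r //.
by apply/eqP => k0; apply: v0; rewrite vk k0 scale0r.
Qed.

Lemma limit_fixed x l : nm_cvg (fun n => rho (g n) x) l -> fixed_space l.
Proof.
move=> gl n; apply: (@nm_cvg_unique _ _ (fun m => rho (g n) (rho (g m) x))).
  move=> e e0; have e2 : 0 < e / 2 by rewrite divr_gt0.
  have [d d0 dP] := small_factor C0 e2; have [N gN] := gl _ d0.
  exists N => m Nm; rewrite -(linB _ _ (rho_linear (@gA n))).
  apply: (@le_lt_trans _ _ (e / 2)); last by rewrite gtr_pMr // invf_lt1 // ltr1n.
  apply: le_trans (rho_contr _ (@gA n) (decreasing_nm_le1 n)) _.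
  by apply: le_trans dP; rewrite ler_wpM2l // ltW // gN.
move=> e e0; have [N gN] := gl _ e0; exists (maxn N n) => m.
rewrite geq_max => /andP[Nm nm']; rewrite -rho_mul //.
by have [_ _ /(_ _ _ nm') [_ ->]] := dg; exact: gN.
Qed.

(** Let P be the strong limit of the rho (g n).  As T is compact,
    rho (g n) T - P T tends to 0 in norm.  As P has rank at most one,
    P T rho (g' n) is <., y n> v, and the vectors y n converge. *)
Lemma corner_limit T g' : B T -> compact_op T -> decreasing_proj g' ->
  exists L, absorbed B L /\ forall e, 0 < e -> exists N, forall n, (N <= n)%N ->
    near_op (fun x => rho (g n) (T (rho (g' n) x))) L e.
Proof.
move=> BT cT dg'; have [g'A gs' gm'] := dg'.
have [P gP] := choice (fun x => decreasing_cvg x dg).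
have bT := B_bounded BT; have /bounded_opP [lT [c c0 cTc]] := bT.
have lg n : linear (rho (g n)) by exact: rho_linear.
have gC n x : nm (rho (g n) x) <= C * nm x.
  by apply: rho_contr => //; exact: decreasing_nm_le1.
have lP : linear P.
  move=> k x y; apply: nm_cvg_unique (gP _) _.
  rewrite (_ : (fun n => _) = (fun n => k *: rho (g n) x + rho (g n) y)).
    exact: nm_cvg_lin.
  by apply: funext => n; rewrite lg.
have bP : bounded_op P.
  by apply/bounded_opP; split=> //; exists C => // x; apply: nm_cvg_bound (gP x) _ => n.
have [v Vv vP] := fixed_space_line.
(* <., v'> is the coordinate along v; it vanishes identically when v = 0. *)
pose v' := Num.conj (hdot v v)^-1 *: v.
have PE x : P x = hdot (P x) v' *: v.
  have [k ->] := vP _ (limit_fixed (gP x)).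
  have [/eqP v0|v0] := boolP (nm v == 0); first by rewrite (nm_eq0 v0) !scaler0.
  rewrite /v' hdotZl hdotZr conjCK mulVf ?mulr1 //.
  by rewrite -nm_sqr (fmorph_eq0 (real_complex R)) sqrf_eq0.
have bPT : bounded_op (P \o T) by apply: bounded_comp.
have [y yP] : exists y : nat -> H, forall n x,
    hdot (P (T (rho (g' n) x))) v' = hdot x (y n).
  suff : forall n, exists y, forall x, hdot (P (T (rho (g' n) x))) v' = hdot x y.
    by move=> /choice [y yP]; exists y.
  move=> n; apply: (adjoint_vector v' (T := (P \o T) \o rho (g' n))).
  by apply: bounded_comp => //; apply: rho_bounded.
have [l yl] := decreasing_adjoint_cvg dg' bPT yP.
pose L := rank1 l v.
have near e : 0 < e -> exists N, forall n, (N <= n)%N ->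
    near_op (fun x => rho (g n) (T (rho (g' n) x))) L e.
  move=> e0; have e2 : 0 < e / 2 by rewrite divr_gt0.
  have [d d0 dP] := small_factor C0 e2.
  have [N NP] := compact_uniform C0 lg gC gP cT d0.
  have [d' d'0 d'P] := small_factor (nm_ge0 v) e2.
  have [M MP] := yl _ d'0.
  exists (maxn N M) => n; rewrite geq_max => /andP[Nn Mn] x.
  apply: le_trans (nm_tri (P (T (rho (g' n) x))) _ _) _.
  rewrite [e]splitr mulrDl; apply: lerD.
    apply: le_trans (NP n Nn _) _; apply: (@le_trans _ _ (C * d * nm x)).
      rewrite (mulrC C) -mulrA ler_wpM2l ?(ltW d0) //.
      apply: rho_contr => //; apply: proj_nm_le1; first exact: gs'.
      exact: (gm' n n (leqnn n)).1.
    by rewrite ler_wpM2r ?nm_ge0.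
  rewrite PE yP /L /rank1 -scalerBl -hdotBr nmZ.
  apply: (@le_trans _ _ (nm x * nm (y n - l) * nm v)).
    by rewrite ler_wpM2r ?nm_ge0 // cauchy_schwarz.
  rewrite -mulrA mulrC ler_wpM2r ?nm_ge0 // mulrC.
  by apply: le_trans d'P; rewrite ler_wpM2l ?nm_ge0 // ltW // MP.
exists L; split => //.
apply: (rank1_absorbed B_bounded B_lin B_comp rho_closed B_0).
apply: (norm_closed_near rho_closed); first exact: rank1_bounded.
move=> e e0; have [N NP] := near e e0.
exists (rho (g N) \o (T \o rho (g' N))).
  apply: B_comp; first by exists (g N).
  by apply: B_comp => //; exists (g' N).
by move=> x; rewrite nm_distC; exact: NP.
Qed.

End FixedSpace.
End Corner.

Lemma near_limit_sum (I : Type) (r : seq I) (W : I -> nat -> H -> H) :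
  (forall u, exists L, absorbed B L /\ forall e, 0 < e -> exists N, forall n,
     (N <= n)%N -> near_op (W u n) L e) ->
  exists L, absorbed B L /\ forall e, 0 < e -> exists N, forall n,
    (N <= n)%N -> near_op (fun x => \sum_(u <- r) W u n x) L e.
Proof.
move=> WL; elim: r => [|u r [L [aL LP]]].
  exists 0; split; first exact: (absorbed0 B_0).
  move=> e e0; exists 0%N => n _ x; rewrite big_nil.
  by rewrite (_ : (0 : H -> H) x = 0) // subr0 nm0 mulr_ge0 ?nm_ge0 ?ltW.
have [M [aM MP]] := WL u; exists (1 *: M + L); split.
  exact: (absorbed_lin B_lin).
move=> e e0; have e2 : 0 < e / 2 by rewrite divr_gt0.
have [N1 h1] := MP _ e2; have [N2 h2] := LP _ e2.
exists (maxn N1 N2) => n; rewrite geq_max => /andP[n1 n2] x.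
rewrite big_cons !fctE scale1r opprD addrACA; apply: le_trans (nmD _ _) _.
by rewrite [e]splitr mulrDl lerD ?h1 ?h2.
Qed.

Section Branch.
Variables (i : nat) (j : taf_block S i) (f : nat -> AF) (T : H -> H).
Hypothesis f_node : forall n, exists s : X (n + i).+1, f n = node psi s.
Hypothesis f_dec : forall n, cmul (f n.+1) (f n) = f n.+1.
Hypothesis BT : B T.
Hypothesis cT : compact_op T.

Let level_le n : (i <= (n + i).+1)%N.
Proof. by rewrite leqW // leq_addl. Qed.

Lemma branch_dec m n : (m <= n)%N -> cmul (f n) (f m) = f n /\ cmul (f m) (f n) = f n.
Proof.
move=> mn; suff nm' : cmul (f n) (f m) = f n.
  split=> //; rewrite -[RHS]nm'; have [s ->] := f_node n; have [t ->] := f_node m.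
  apply: (node_comm AF_limit); apply: diag_mono (node_diag _ t) => //.
  by rewrite ltnS leq_add2r.
move: mn => /subnK <-; elim: (n - m)%N => [|k IH].
  by have [s ->] := f_node m; exact: node_idem.
by rewrite addSn -[in RHS](f_dec (k + m)) -[in RHS]IH cmulA f_dec.
Qed.

Let f_comm n : cmul (level_unit psi (base j) (base j)) (f n) =
  cmul (f n) (level_unit psi (base j) (base j)).
Proof. by have [s ->] := f_node n; apply: base_node. Qed.

Lemma branch_decreasing p : decreasing_proj (fun n => cut_unit psi (j := j) p p (f n)).
Proof.
split=> [n|n|m n mn].
- have [s ->] := f_node n; apply: upp_taf.
  exact: ((diag_levelP AF_limit _ _).1 (cut_unit_diag AF_limit p s (level_le n))).1.
- by rewrite cut_unit_star //; have [s ->] := f_node n; exact: node_star.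
- by rewrite !cut_unit_mul ?f_comm // eqxx (branch_dec mn).1 (branch_dec mn).2.
Qed.

Lemma branch_corner p k b : upper_level psi k b -> exists N, forall n, (N <= n)%N ->
  exists c, cmul (cmul (cut_unit psi (j := j) p p (f n)) b) (cut_unit psi p p (f n)) =
    c *: cut_unit psi p p (f n).
Proof.
move=> /upp_full fb; exists k => n kn; have [s ->] := f_node n.
apply: cut_unit_corner => //; apply: (full_mono AF_limit) fb.
by rewrite leqW // (leq_trans kn) // leq_addr.
Qed.

(** The orbit projection is the sum of its diagonal cut units, so the compression
    of T is a finite sum of corners. *)
Lemma branch_limit : exists L, absorbed B L /\ forall e, 0 < e ->
  exists N, forall n, (N <= n)%N ->
    near_op (fun x => rho (block_proj psi j (f n)) (T (rho (block_proj psi j (f n)) x))) L e.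
Proof.
pose h p n := cut_unit psi (j := j) p p (f n).
have [|L [aL LP]] := @near_limit_sum _ (index_enum _)
    (fun (u : 'I_(taf_size j) * 'I_(taf_size j)) n x => rho (h u.1 n) (T (rho (h u.2 n) x))).
  move=> u; apply: corner_limit => //; try exact: branch_decreasing.
  by move=> k b; exact: branch_corner.
exists L; split=> // e e0; have [N NP] := LP e e0; exists N => n Nn x.
have hA p : A (h p n) by have [+ _ _] := branch_decreasing p; apply.
rewrite (_ : rho _ _ = \sum_u rho (h u.1 n) (T (rho (h u.2 n) x))); first exact: NP.
have lT := (B_bounded BT).1.
rewrite /block_proj rho_sum // rho_sum // (lin_sum _ _ lT).
rewrite -(pair_bigA _ (fun p q => rho (h p n) (T (rho (h q n) x)))) /=.
by apply: eq_bigr => p _; rewrite (lin_sum _ _ (rho_linear (hA p))).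
Qed.

End Branch.

Section Koenig.
Variables (T : H -> H) (i : nat) (del : R).
Hypothesis BT : B T.
Hypothesis cT : compact_op T.
Hypothesis del0 : 0 < del.

Definition approximable (j : taf_block S i) (t : AF) := exists2 L, absorbed B L &
  near_op (fun x => rho (block_proj psi j t) (T (rho (block_proj psi j t) x))) L del.

Lemma approximable0 j : approximable j 0.
Proof.
exists 0; first exact: (absorbed0 B_0).
move=> x; rewrite block_proj0 !rho0 (_ : (0 : H -> H) x = 0) // subr0 nm0.
by rewrite mulr_ge0 ?nm_ge0 ?ltW.
Qed.

(** Koenig's lemma.  If inapproximable nodes occur at arbitrarily high levels,
    some decreasing sequence of nodes always has such nodes below it.  The
    compressions along the sequence converge to an absorbed operator L, and
    compressing further brings L close to the compression at an inapproximable
    node below. *)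
Lemma approximable_eventually : exists N, forall k, (N <= k)%N ->
  forall j (s : X k), approximable j (node psi s).
Proof.
apply: contrapT => /forallNP never.
have {never} [j jP] : exists j, forall N, exists k, (N <= k)%N /\
    exists s : X k, ~ approximable j (node psi s).
  apply: inf_pigeon => N.
  have /existsNP [k /not_implyP [Nk /existsNP [j /existsNP [s ns]]]] := never N.
  by exists k; split=> //; exists j, s.
(* The root is the unit of level i; from then on the members of the chain are
   nodes. *)
pose G n (x : AF) := [/\ diag_level psi (n + i) x, cmul x x = x & forall N, exists k, (N <= k)%N /\
  exists s : X k, cmul (node psi s) x = node psi s /\ ~ approximable j (node psi s)].
pose E n (x y : AF) := (exists s : X (n + i).+1, y = node psi s) /\ cmul y x = y.
have oneG : G 0%N (level_one psi i).
  split; first exact: one_diag.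
    by apply: one_mull => //; exists mm1.
  move=> N; have [k [Nk [s ns]]] := jP (maxn N i); exists k.
  move: Nk; rewrite geq_max => /andP[Nk ik]; split=> //; exists s; split=> //.
  have := @node_dichotomy _ _ _ _ AF_limit k s (level_one psi i).
  case=> //; first by apply: (diag_mono AF_limit ik); exact: one_diag.
    by apply: one_mull => //; exists mm1.
  move=> s0; case: ns; rewrite /approximable (_ : block_proj psi j _ = block_proj psi j 0).
    exact: approximable0.
  apply: eq_bigr => p _; rewrite /cut_unit cmul0r cmul0l.
  rewrite -(one_mull AF_limit (level_unit_full psi (base j) p)).
  by rewrite -cmulA (cmulA (node psi s)) s0 cmul0l cmul0r.
have step n (x : AF) : G n x -> exists y : AF, G n.+1 y /\ E n x y.
  move=> [dx xx xP].
  have [s' s'P] : exists s' : X (n + i).+1, forall N, exists k, (N <= k)%N /\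
      (cmul (node psi s') x = node psi s' /\ exists s : X k,
       cmul (node psi s) (node psi s') = node psi s /\ ~ approximable j (node psi s)).
    apply: inf_pigeon => N; have [k [Nk [s [sx ns]]]] := xP (maxn N (n + i).+1).
    move: Nk; rewrite geq_max => /andP[Nk ik].
    have [s' [ss' s'x]] := node_child AF_limit ik dx xx sx.
    by exists k; split=> //; exists s'; split=> //; exists s.
  exists (node psi s'); split; last first.
    by split; [exists s'|have [k [_ [->]]] := s'P 0%N].
  split; [exact: node_diag|exact: node_idem|].
  by move=> N; have [k [Nk [_ sP]]] := s'P N; exists k.
have [f fP] := dependent_chain oneG step.
have f_node n : exists s : X (n + i).+1, f n.+1 = node psi s by have [_ []] := fP n.
have f_dec n : cmul (f n.+2) (f n.+1) = f n.+2 by have [_ []] := fP n.+1.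
have [L [aL LP]] := @branch_limit i j (fun n => f n.+1) T f_node f_dec BT cT.
have [d d0 dP] := small_factor (mulr_ge0 C0 C0) del0.
have [N NP] := LP _ d0; have {NP} near := NP N (leqnn N).
have [[df ff fk] _] := fP N.+1.
have [k [Nk [s [sf ns]]]] := fk (N.+1 + i)%N.
apply: ns; set q := block_proj psi j (node psi s); set b := block_proj psi j (f N.+1) in near.
have ik : (i <= k)%N by apply: leq_trans Nk; apply: leq_addl.
have Aq : A q by apply: upp_taf; exact: block_proj_upp.
have Ab : A b.
  rewrite /b; have [t ->] := f_node N; apply: upp_taf; apply: block_proj_upp => //.
  by rewrite leqW // leq_addl.
have fc : cmul (level_unit psi (base j) (base j)) (f N.+1) =
    cmul (f N.+1) (level_unit psi (base j) (base j)).
  have [t ->] := f_node N; apply: base_node => //.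
  by rewrite leqW // leq_addl.
have qb : cmul q b = q by rewrite /q /b block_proj_mul // sf.
have bq : cmul b q = q.
  rewrite /q /b block_proj_mul //; last exact: base_node.
  by rewrite (node_comm AF_limit) ?sf //; apply: diag_mono df.
have q1 : nm q <= 1.
  apply: proj_nm_le1; first by rewrite /q block_proj_star // node_star.
  by rewrite /q block_proj_mul ?node_idem //; exact: base_node.
exists (rho q \o (L \o rho q)).
  apply: (absorbed_compl B_bounded B_comp); first by exists q.
  by apply: (absorbed_compr B_bounded B_comp) => //; exists q.
move=> x /=; have -> : rho q (T (rho q x)) = rho q (rho b (T (rho b (rho q x)))).
  by rewrite -!rho_mul // qb bq.
rewrite -(linB _ _ (rho_linear Aq)); apply: le_trans (rho_contr _ Aq q1) _.
apply: le_trans (ler_wpM2l C0 (near _)) _.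
apply: (@le_trans _ _ (C * (d * (C * nm x)))).
  by rewrite !ler_wpM2l ?(ltW d0) // rho_contr.
apply: (@le_trans _ _ (C * C * d * nm x)); last by rewrite ler_wpM2r ?nm_ge0.
by rewrite !mulrA (mulrAC C d).
Qed.

End Koenig.

(** T is close to rho b, with b in some level, and b is its own pinching; hence T
    is close to its pinching, whose blocks are close to absorbed operators. *)
Theorem compact_absorbed T : B T -> compact_op T -> absorbed B T.
Proof.
move=> BT cT; apply: (absorbed_closed B_bounded rho_closed BT) => e e0.
have [a Aa aT] := BT.
(* The three terms bound T - rho b, the pinching of rho b - T, and the blocks. *)
have K0 : 0 <= C + C * (C * C * C) + C * (C * C) by rewrite !addr_ge0 ?mulr_ge0.
have [d d0 dP] := small_factor K0 e0.
have [i [b ub ab]] := (tafP _ _).1 Aa _ d0.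
have Ab : A b by exact: upp_taf ub.
have [N NP] := approximable_eventually i BT cT d0.
pose k := maxn N i; have ik : (i <= k)%N by exact: leq_maxr.
pose c := @cell R S AF psi i k.
have cA u : A (c u) by apply: upp_taf; exact: block_proj_upp.
have cP : orthoproj (index_enum _) c by exact: cell_orthoproj.
have c1 u : nm (c u) <= 1.
  by have [su uu] := cP.1 u (mem_index_enum _); exact: proj_nm_le1.
have [L LP] : exists L : taf_block S i * X k -> H -> H, forall u, absorbed B (L u) /\
    near_op (fun x => rho (c u) (T (rho (c u) x))) (L u) d.
  suff /choice [L LP] : forall u : taf_block S i * X k, exists M, absorbed B M /\
      near_op (fun x => rho (c u) (T (rho (c u) x))) M d by exists L.
  move=> u; have [M aM MP] := NP k (leq_maxl _ _) u.1 u.2.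
  by exists M.
have lc u : linear (rho (c u)) by exact: rho_linear.
exists (fun x => \sum_u rho (c u) (L u (rho (c u) x))).
  apply: (absorbed_sum B_lin B_0) => u.
  apply: (absorbed_compl B_bounded B_comp (S := rho (c u)) (T := L u \o rho (c u))).
    by exists (c u).
  by apply: (absorbed_compr B_bounded B_comp); [exists (c u)|exact: (LP u).1].
move=> x.
have Aba : A (b - a) by rewrite addrC -scaleN1r; apply: taf_lin.
have nba y : nm (rho (b - a) y) <= C * d * nm y.
  apply: le_trans (rhoC _ Aba) _; rewrite ler_wpM2r ?nm_ge0 // ler_wpM2l //.
  by rewrite nm_distC ltW.
pose W1 (u : taf_block S i * X k) := rho (b - a).
pose W2 u y := rho (c u) (T (rho (c u) y)) - L u y.
have -> : T x - \sum_u rho (c u) (L u (rho (c u) x)) = - rho (b - a) x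
   + \sum_u rho (c u) (W1 u (rho (c u) x))
   + \sum_u rho (c u) (W2 u (rho (c u) x)).
  have bE : rho b x = \sum_u rho (c u) (rho b (rho (c u) x)).
    rewrite -{1}(cell_pinch AF_limit ik (upp_full ub)) rho_sum.
      by apply: eq_bigr => u _; rewrite !rho_mul //; exact: taf_mul.
    by move=> u; do 2?apply: taf_mul.
  have e1 : \sum_u rho (c u) (W1 u (rho (c u) x)) =
      rho b x - \sum_u rho (c u) (T (rho (c u) x)).
    rewrite bE -sumrB; apply: eq_bigr => u _.
    by rewrite /W1 rhoB // (linB _ _ (lc u)) aT.
  have e2 : \sum_u rho (c u) (W2 u (rho (c u) x)) =
      \sum_u rho (c u) (T (rho (c u) x)) - \sum_u rho (c u) (L u (rho (c u) x)).
    rewrite -sumrB; apply: eq_bigr => u _.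
    have cc : cmul (c u) (c u) = c u by have [] := cP.1 u (mem_index_enum _).
    by rewrite /W2 (linB _ _ (lc u)) -!rho_mul // cc.
  by rewrite e1 e2 rhoB // aT opprB !addrA !subrK.
apply: (@le_trans _ _ (C * d * nm x + C * (C * (C * d) * (C * nm x))
   + C * (C * d * (C * nm x)))); last first.
  apply: (@le_trans _ _ ((C + C * (C * C * C) + C * (C * C)) * d * nm x)).
    by rewrite le_eqVlt; apply/orP; left; apply/eqP; ring.
  by rewrite ler_wpM2r ?nm_ge0.
apply: le_trans (nmD _ _) _; apply: lerD.
  apply: le_trans (nmD _ _) _; rewrite nmN lerD ?nba //.
  apply: block_diagonal_bound => //; first exact: index_enum_uniq.
    by apply: mulr_ge0 => //; apply: mulr_ge0 => //; apply: ltW.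
  move=> u y; apply: le_trans (rho_contr _ (cA u) (c1 u)) _.
  by rewrite -mulrA ler_wpM2l //; apply: nba.
apply: block_diagonal_bound => //; first exact: index_enum_uniq.
  by apply: mulr_ge0 => //; apply: ltW.
move=> u y; apply: le_trans (rho_contr _ (cA u) (c1 u)) _.
by rewrite -mulrA ler_wpM2l //; apply: (LP u).2.
Qed.

End Bound.

End Representation.


Theorem theorem3p9 (R : realType) (S : taf_system R) (AF : cstarAlgType R)
  (psi : forall i, multimx R (@taf_size R S i) -> AF)
  (AF_limit : cstar_limit psi)
  (H : hilbertType R) (rho : AF -> H -> H)
  (rho_nest : nest_representation (taf_algebra psi) rho)
  (rho_closed : norm_closed (rho @` taf_algebra psi)) :
  closed_ideal (alg (lat (rho @` taf_algebra psi)))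
    [set T | (rho @` taf_algebra psi) T /\ compact_op T].
Proof.
have [C C0 rhoC] := rho_bound rho_nest.
have bounded := B_bounded rho_nest; have lin := B_lin AF_limit rho_nest.
split.
- by move=> T [BT _]; apply: sub_alg_lat.
- split=> [|k T U [BT cT] [BU cU]].
    by split; [exact: (B_0 AF_limit rho_nest)|exact: compact_op0].
  by split; [exact: lin|exact: compact_op_lin].
- move=> T U aT [BU cU].
  have [_ /(_ T aT) [TU UT]] :=
    compact_absorbed AF_limit rho_nest rho_closed C0 rhoC BU cU.
  have [bT _] := aT; split; split=> //.
    exact: compact_op_compl.
  exact: compact_op_compr.
move=> T bT TI; split.
  by apply: rho_closed => // e /TI [U [BU _] TU]; exists U.
apply: compact_op_closed => // e /TI [U [BU cU] TU]; exists U => // x.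
by apply: (opnorm_lt _ TU); apply: bounded_sub => //; exact: bounded.
Qed.
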